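(* Let $\mathcal{G}$ be an \'etale groupoid with the Fourier coefficients approximation property, let $\Gamma$ be a countable infinite abelian group (written additively, with identity $0$), let $c:\mathcal{G}\to\Gamma$ be a continuous $1$-cocycle, and put $\mathcal{G}_t=c^{-1}(t)$ for $t\in\Gamma$. Assume that the unit space $\mathcal{G}^{(0)}$ is totally disconnected, that $\Gamma$ has a subsemigroup $\mathcal{P}$ containing $0$ and satisfying $\Gamma=\mathcal{P}-\mathcal{P}$, and that the kernel $\mathcal{G}_0$ of $c$ is amenable and principal. Suppose that for each $p\in\mathcal{P}$ there exists a cover $\{U_{p,i}\mid i\in\Lambda_p\}$ of $\mathcal{G}_p$ by compact open bisections of $\mathcal{G}$ (with $U_{p,i}\subseteq\mathcal{G}_p$), such that the collection $$\{U_{p,i}U_{q,j}^{-1}\mid p,q\in\mathcal{P},\ i\in\Lambda_p,\ j\in\Lambda_q,\ s(U_{p,i})=s(U_{q,j})\}$$ forms an open cover of $\mathcal{G}$. Then a diagonal bimodule $M$ of $C_r^*(\mathcal{G})$ is spectral if and only if $M$ is $\alpha^c$-invariant.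
   Context: An \'etale groupoid means a second countable, locally compact, Hausdorff topological groupoid $\mathcal{G}$ whose range and source maps $r,s:\mathcal{G}\to\mathcal{G}^{(0)}$ are local homeomorphisms; $\mathcal{G}^{(0)}$ is the unit space and, for a unit $u$, $\mathcal{G}_u$ denotes $s^{-1}(u)$. A bisection is a subset of $\mathcal{G}$ on which both $r$ and $s$ are injective. $\mathcal{G}$ is principal if every $\gamma$ with $r(\gamma)=s(\gamma)$ is a unit; amenability is (topological) amenability. For $A,B\subseteq\mathcal{G}$, $AB=\{\alpha\beta:\alpha\in A,\beta\in B,s(\alpha)=r(\beta)\}$ and $A^{-1}=\{\alpha^{-1}:\alpha\in A\}$. $C_c(\mathcal{G})$ is a $*$-algebra with $f^*(\gamma)=\overline{f(\gamma^{-1})}$ and $(fg)(\gamma)=\sum_{\gamma'\in s^{-1}(s(\gamma))}f(\gamma\gamma'^{-1})g(\gamma')$; $C_r^*(\mathcal{G})$ is its completion in the norm $\|f\|_{\mathrm{red}}=\sup_{u\in\mathcal{G}^{(0)}}\|\mathrm{Ind}_u(f)\|$, where $\mathrm{Ind}_u(f)\xi(\gamma)=\sum_{\gamma'\in s^{-1}(u)}f(\gamma\gamma'^{-1})\xi(\gamma')$ on $\ell^2(s^{-1}(u))$. The inclusion $C_c(\mathcal{G})\subseteq C_0(\mathcal{G})$ extends to a norm-decreasing injective linear map $j:C_r^*(\mathcal{G})\to C_0(\mathcal{G})$, and each $a\in C_r^*(\mathcal{G})$ is identified with the function $j(a)$; write $a(\gamma)=j(a)(\gamma)$ and $\mathrm{supp}'(a)=\{\gamma\in\mathcal{G}:a(\gamma)\neq0\}$.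 $C_0(\mathcal{G}^{(0)})$ is regarded as a $C^*$-subalgebra of $C_r^*(\mathcal{G})$. For open $P\subseteq\mathcal{G}$, $C_c(P)\subseteq C_c(\mathcal{G})$ via extension by zero. A diagonal bimodule of $C_r^*(\mathcal{G})$ is a norm closed subspace $M$ such that $ab,ba\in M$ for all $a\in M$, $b\in C_0(\mathcal{G}^{(0)})$. Its spectrum is $\sigma(M)=\{\gamma\in\mathcal{G}:a(\gamma)\ne0\text{ for some }a\in M\}$. For open $P\subseteq\mathcal{G}$, $A(P)=\{a\in C_r^*(\mathcal{G}):a(\gamma)=0\text{ for all }\gamma\notin P\}$ (so $A(\emptyset)=\{0\}$). $M$ is spectral if $M=A(\sigma(M))$. $\mathcal{G}$ has the Fourier coefficients approximation property if $a\in\overline{C_c(\mathrm{supp}'(a))}$ (closure in the reduced norm) for all $a\in C_r^*(\mathcal{G})$. A continuous $1$-cocycle is a continuous groupoid homomorphism $c:\mathcal{G}\to\Gamma$ ($\Gamma$ discrete). The cocycle induces an action $\alpha^c$ of the dual group $\widehat\Gamma$ by automorphisms of $C_r^*(\mathcal{G})$ with $\alpha^c_\chi(a)(\gamma)=\chi(c(\gamma))a(\gamma)$ for $\chi\in\widehat\Gamma$, $a\in C_r^*(\mathcal{G})$, $\gamma\in\mathcal{G}$. $M$ is $\alpha^c$-invariant if $\alpha^c_\chi(M)\subseteq M$ for all $\chi\in\widehat\Gamma$. *)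

(* Defs.v *)
From HB Require Import structures.
From mathcomp Require Import all_boot all_order all_algebra.
From mathcomp Require Import complex.
From mathcomp Require Import all_classical all_reals all_analysis.

Set Implicit Arguments.
Unset Strict Implicit.
Unset Printing Implicit Defensive.

Import Order.TTheory GRing.Theory Num.Theory.
Import numFieldNormedType.Exports.

Local Open Scope classical_set_scope.
Local Open Scope ring_scope.
Local Open Scope complex_scope.

(* R[i] has no topology in the libraries: give it the one of its modulus. *)
HB.instance Definition _ (R : realType) := NormedModule.copy R[i] R[i]^o.

(* [mul] is total; [mul g h] is meaningful only if [src g = rng h], and the
   axioms constrain it only in that case. *)
Record groupoid (G : Type) := Groupoid {
  src : G -> G;
  rng : G -> G;
  inv : G -> G;
  mul : G -> G -> G;
  src_src : forall g, src (src g) = src g;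
  rng_src : forall g, rng (src g) = src g;
  src_rng : forall g, src (rng g) = rng g;
  rng_rng : forall g, rng (rng g) = rng g;
  src_mul : forall g h, src g = rng h -> src (mul g h) = src h;
  rng_mul : forall g h, src g = rng h -> rng (mul g h) = rng g;
  mul_assoc : forall g h k, src g = rng h -> src h = rng k ->
    mul g (mul h k) = mul (mul g h) k;
  mul_src : forall g, mul g (src g) = g;
  rng_mull : forall g, mul (rng g) g = g;
  src_inv : forall g, src (inv g) = rng g;
  rng_inv : forall g, rng (inv g) = src g;
  mul_inv : forall g, mul g (inv g) = rng g;
  inv_mul : forall g, mul (inv g) g = src g
}.

(* [f], with values in [B], is a local homeomorphism onto relatively open
   subsets of [B]; [g] is the inverse of [f] restricted to [U]. *)
Definition local_homeomorphism (X Y : topologicalType) (f : X -> Y)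
    (B : set Y) : Prop :=
  (forall x, B (f x)) /\
  forall x, exists U : set X,
    [/\ open U, U x,
        exists2 W, open W & f @` U = W `&` B,
        {within U, continuous f} &
        exists2 g : Y -> X, (forall y, U y -> g (f y) = y) &
                            {within f @` U, continuous g}].

Section EtaleGroupoid.
Variables (G : topologicalType) (Gr : groupoid G).

Definition units : set G := range (src Gr).

Definition composable : set (G * G) := [set p | src Gr p.1 = rng Gr p.2].

Definition topological_groupoid : Prop :=
  {within composable, continuous (fun p => mul Gr p.1 p.2)} /\
  continuous (inv Gr).

Definition etale : Prop :=
  [/\ @second_countable G, locally_compact [set: G], hausdorff_space G,
      topological_groupoid &
      local_homeomorphism (src Gr) units /\ local_homeomorphism (rng Gr) units].

Definition bisection (U : set G) : Prop :=
  {in U &, injective (src Gr)} /\ {in U &, injective (rng Gr)}.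

Definition set_mul (A B : set G) : set G :=
  [set mul Gr p.1 p.2 | p in composable `&` (A `*` B)].

Definition set_inv (A : set G) : set G := inv Gr @` A.

(* C_c(P), for P open, viewed in C_c(G) through extension by zero. *)
Definition Cc (K : numFieldType) (V : normedModType K) (P : set G) :
    set (G -> V) :=
  [set f | [/\ continuous f, compact (closure [set g | f g != 0]) &
               closure [set g | f g != 0] `<=` P]].

(* The next two notions concern an open subgroupoid [H] of [Gr]. *)

Definition principal_on (H : set G) : Prop :=
  forall g, H g -> rng Gr g = src Gr g -> units g.

(* Topological amenability of an etale groupoid: there is a net of nonnegative
   functions mu_i in C_c(H) with
     \sum_(h in H^x) mu_i(h) --> 1, uniformly on compact sets of units x,
     \sum_(h in H^(r(g))) |mu_i(g^-1 h) - mu_i(h)| --> 0, uniformly on compact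
       sets of arrows g.
   All these sums have finite support. *)
Definition amenable_on (R : realType) (H : set G) : Prop :=
  exists (I : Type) (F : set_system I) (mu : I -> G -> R),
    [/\ ProperFilter F,
        forall i, Cc H (mu i) /\ (forall g, 0 <= mu i g),
        forall K : set G, compact K -> K `<=` H `&` units ->
          forall e : R, 0 < e ->
          F [set i | forall x, K x ->
            `| \sum_(h \in [set h | H h /\ rng Gr h = x]) mu i h - 1 | < e] &
        forall K : set G, compact K -> K `<=` H ->
          forall e : R, 0 < e ->
          F [set i | forall g, K g ->
            \sum_(h \in [set h | H h /\ rng Gr h = rng Gr g])
              `| mu i (mul Gr (inv Gr g) h) - mu i h | < e]].

End EtaleGroupoid.

Section ReducedAlgebra.
Variables (R : realType) (G : topologicalType) (Gr : groupoid G).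
Implicit Types (f g a b : G -> R[i]) (u : G) (M : set (G -> R[i])).

Definition fiber u : set G := [set h | src Gr h = u].

Definition conv f g : G -> R[i] := fun x =>
  \sum_(h \in fiber (src Gr x)) f (mul Gr x (inv Gr h)) * g h.

(* Vectors of l^2(G_u) are functions on G, of which only the values on the
   fiber G_u matter. *)
Definition l2norm u (xi : G -> R[i]) : \bar R :=
  ((\esum_(h in fiber u) ((Normc.normc (xi h)) ^+ 2)%:E) `^ 2^-1)%E.

Definition Ind u f (xi : G -> R[i]) : G -> R[i] := fun x =>
  \sum_(h \in fiber u) f (mul Gr x (inv Gr h)) * xi h.

Definition Ind_norm u f : \bar R :=
  ereal_sup [set l2norm u (Ind u f xi) | xi in [set xi | (l2norm u xi <= 1)%E]].

(* The supremum is finite for f in C_c(G), the only case in which this is used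
   (if G is empty, it is -oo and [fine] gives 0). *)
Definition red_norm f : R :=
  fine (ereal_sup [set Ind_norm u f | u in units Gr]).

(* [represents f_ a]: the sequence [f_] in C_c(G) is Cauchy for the reduced
   norm, hence defines an element of the completion C*_r(G), and [a] is the image
   of this element under the map j : C*_r(G) -> C_0(G) which extends
   C_c(G) -> C_0(G) by continuity. *)
Definition represents (f_ : nat -> G -> R[i]) a : Prop :=
  [/\ forall n, Cc [set: G] (f_ n),
      forall e : R, 0 < e ->
        \forall m & n \near \oo, red_norm (f_ m \- f_ n) < e &
      {uniform, f_ n @[n --> \oo] --> a}].

(* C*_r(G), its elements being identified with functions on G through the
   injective map j. *)
Definition Cr : set (G -> R[i]) := [set a | exists f_ : nat -> G -> R[i], represents f_ a].

(* Norm and product of the completion. As j is injective, the limits obtained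
   from the different sequences representing the arguments coincide. *)
Definition Cr_norm a : R :=
  inf [set x | exists2 f_ : nat -> G -> R[i], represents f_ a &
                           red_norm (f_ n) @[n --> \oo] --> x].

Definition Cr_mul a b : G -> R[i] :=
  get [set k | exists f_ g_ : nat -> G -> R[i],
    [/\ represents f_ a, represents g_ b &
        represents (fun n => conv (f_ n) (g_ n)) k]].

Definition Cr_closure M : set (G -> R[i]) :=
  [set a | Cr a /\ forall e : R, 0 < e ->
                   exists2 b, M b & Cr_norm (a \- b) < e].

(* C_0(G^(0)), viewed in C*_r(G) through extension by zero. *)
Definition C0_units : set (G -> R[i]) :=
  [set b | [/\ {within units Gr, continuous b},
               forall x, ~ units Gr x -> b x = 0 &
               forall e : R, 0 < e -> exists K : set G,
                 [/\ compact K, K `<=` units Gr &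
                     forall x, units Gr x -> ~ K x -> Normc.normc (b x) < e]]].

Definition supp' a : set G := [set x | a x != 0].

Definition diagonal_bimodule M : Prop :=
  [/\ M `<=` Cr,
      M (fun=> 0) /\
        (forall (z : R[i]) a b, M a -> M b -> M (fun x => z * a x + b x)),
      Cr_closure M `<=` M &
      forall a b, M a -> C0_units b -> M (Cr_mul a b) /\ M (Cr_mul b a)].

Definition spectrum M : set G := [set x | exists2 a, M a & a x != 0].

Definition A_of (P : set G) : set (G -> R[i]) :=
  [set a | Cr a /\ forall x, ~ P x -> a x = 0].

Definition spectral M : Prop := M = A_of (spectrum M).

Definition Fourier_approximation : Prop :=
  forall a, Cr a -> Cr_closure (Cc (supp' a)) a.

End ReducedAlgebra.

Definition cocycle (G : topologicalType) (Gr : groupoid G) (Gam : zmodType)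
    (c : G -> Gam) : Prop :=
  continuous (c : G -> discrete_topology Gam) /\
  forall g h, src Gr g = rng Gr h -> c (mul Gr g h) = c g + c h.

Definition unitary_character (R : realType) (Gam : zmodType)
    (chi : Gam -> R[i]) : Prop :=
  (forall t, `| chi t | = 1) /\ (forall s t, chi (s + t) = chi s * chi t).

Definition dual_action (R : realType) (G : Type) (Gam : zmodType)
    (c : G -> Gam) (chi : Gam -> R[i]) (a : G -> R[i]) : G -> R[i] :=
  fun x => chi (c x) * a x.

Definition dual_invariant (R : realType) (G : Type) (Gam : zmodType)
    (c : G -> Gam) (M : set (G -> R[i])) : Prop :=
  forall chi, unitary_character chi -> dual_action c chi @` M `<=` M.

(* Main.v *)
Require Import Defs.
From HB Require Import structures.
From mathcomp Require Import all_boot all_order all_algebra.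
From mathcomp Require Import complex.
From mathcomp Require Import finmap.
From mathcomp Require Import all_classical all_reals all_analysis.
From mathcomp Require Import ring lra.

Import Order.TTheory GRing.Theory Num.Theory.
Import numFieldNormedType.Exports.

Local Open Scope classical_set_scope.
Local Open Scope ring_scope.
Local Open Scope complex_scope.

Set Implicit Arguments.
Unset Strict Implicit.
Unset Printing Implicit Defensive.

(** By the approximation property, an element of [A(P)] is a limit of functions in
    [C_c(P)], so a bimodule [M] is spectral as soon as it contains [C_c] of its
    spectrum; and a spectral [M], being some [A(P)], is invariant because
    multiplying by a character of the cocycle does not move supports. What has to be
    shown is that an invariant [M] contains [C_c] of its spectrum, and this is a
    local statement: if [a] in [M] does not vanish on a
    small compact open bisection [V] inside a level set of the cocycle, then [M]
    contains [C_c(V)].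

    The heart of the matter is that the restriction of [a] to [V] lies in [M]
    ([bimodule_restriction]). Choose [f] in [C_c(G)] close to [a]. The support of
    [f] is compact, so it meets finitely many level sets. Characters of the group
    separate its points by roots of unity ([character_root_of_unity]), so finite
    averages of the dual action isolate the level of [V] exactly
    ([levels_multiplier]). Inside this level, principality of the kernel says that
    an arrow is determined by its range and source, so the rest of the support of
    [f] contains no arrow parallel to an arrow of [V]; cutting [V] into small
    disjoint pieces [V_k], the block compression, which maps [a] to the sum of the
    [1_(r V_k) a 1_(s V_k)], kills that rest and is the identity on [V]
    ([block_multiplier]). Both operations are pointwise multiplications, preserve
    [M], and do not increase the reduced norm; on [f] their composite is the
    restriction to [V], which is also contractive. Hence the restriction of [a] is
    within twice the distance from [f] to [a] of an element of [M], and [M] is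
    closed. Dividing a function in
    [C_c(V)] by [a] then gives a diagonal factor ([bimodule_Cc_bisection]), and
    compact open bisections, which form a base because the unit space is totally
    disconnected, replace partitions of unity ([etale_Cc_ind]).

    All norm estimates go through [opbound], a bound on the matrices of the
    regular representations tested on finitely supported vectors. On [C_c(G)] the
    least such bound is the reduced norm ([red_norm_le], [red_norm_opbound]), and
    approximation in this sense characterizes the completion as a set of functions
    ([CrP], [Cr_norm_le]). *)

(** * Characters of a discrete abelian group *)

Section Characters.
Variables (R : realType) (Gam : zmodType).
Implicit Types (S : set (Gam * R[i])) (g : Gam) (z : R[i]).

(** A unitary character on a subgroup, given by its graph: chains of partial
    characters then have their union as an upper bound. *)
Definition partial_character S : Prop :=
  [/\ S (0, 1),
      forall p q, S p -> S q -> S (p.1 - q.1, p.2 / q.2),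
      forall p, S p -> `|p.2| = 1 &
      forall z, S (0, z) -> z = 1].

Lemma partial_character_fun S g z w :
  partial_character S -> S (g, z) -> S (g, w) -> z = w.
Proof.
move=> [_ SB S1 S0] Sz Sw; have := SB _ _ Sz Sw; rewrite /= subrr => /S0.
by move=> /divr1_eq.
Qed.

Lemma partial_characterXn S g z n :
  partial_character S -> S (g, z) -> S (g *+ n, z ^+ n).
Proof.
move=> [S01 SB S1 S0] Sz; elim: n => [|n IH]; first by rewrite mulr0n expr0.
have := SB _ _ IH (SB _ _ S01 Sz); rewrite /= sub0r opprK div1r invrK.
by rewrite -mulrSr -exprSr.
Qed.

Lemma partial_characterXz S g z (k : int) :
  partial_character S -> S (g, z) -> S (g *~ k, z ^ k).
Proof.
move=> hS Sz; case: k => n; first exact: partial_characterXn.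
have [S01 SB S1 S0] := hS.
have := SB _ _ S01 (partial_characterXn n.+1 hS Sz).
by rewrite /= sub0r div1r.
Qed.

(** A value [z] at [g] extends a partial character as soon as it agrees with it
    on the multiples of [g] that already lie in the domain. *)
Lemma extend_partial_character S g z :
  partial_character S -> `|z| = 1 ->
  (forall (k : int) w, S (g *~ k, w) -> w = z ^ k) ->
  exists S', [/\ partial_character S', S `<=` S' & S' (g, z)].
Proof.
move=> hS z1 hz; have [S01 SB S1 S0] := hS.
have z0 : z != 0 by rewrite -normr_eq0 z1 oner_eq0.
have zu : z \is a GRing.unit by rewrite unitfE.
exists [set p | exists q (k : int), S q /\ p = (q.1 + g *~ k, q.2 * z ^ k)].
split; first split.
- by exists (0, 1), 0; rewrite /= mulr0z addr0 mul1r expr0z.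
- move=> _ _ [q [k [Sq ->]]] [r [l [Sr ->]]] /=.
  exists (q.1 - r.1, q.2 / r.2), (k - l); split; first exact: SB.
  congr pair => /=; first by rewrite mulrzBr opprD addrACA.
  by rewrite expfzDr// -invr_expz invfM mulrACA.
- move=> _ [q [k [Sq ->]]] /=; rewrite normrM (S1 _ Sq) mul1r.
  by case: k => n; rewrite ?normrX/= ?normfV ?normrX z1 expr1n ?invr1.
- move=> w [[h y] [k [Sq [e ->]]]] /=; have {e} e : h = g *~ (- k).
    by rewrite mulrNz; apply/eqP; rewrite -addr_eq0 -e.
  by rewrite e in Sq; rewrite (hz _ _ Sq) -invr_expz mulVf// expfz_neq0.
- by move=> p Sp; exists p, 0; rewrite mulr0z addr0 expr0z mulr1 -surjective_pairing.
- by exists (0, 1), 1; rewrite /= mulr1z add0r mul1r expr1z.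
Qed.

(** Divisibility of the circle: if a positive multiple of [g] lies in the
    domain, take the least one and extract a root; otherwise any value will
    do. *)
Lemma partial_character_step S g :
  partial_character S ->
  exists S', [/\ partial_character S', S `<=` S' & exists z, S' (g, z)].
Proof.
move=> hS; have [S01 SB S1 S0] := hS.
suff [z [z1 hz]] : exists z, `|z| = 1 /\
    (forall (k : int) w, S (g *~ k, w) -> w = z ^ k).
  have [S' [? ? ?]] := extend_partial_character hS z1 hz.
  by exists S'; split => //; exists z.
have [[n n0]|nex] := pselect (exists2 n, (0 < n)%N & exists w, S (g *+ n, w)).
- move=> exw; have ex : exists n, (0 < n)%N && `[< exists w, S (g *+ n, w) >].
    by exists n; rewrite n0; apply/asboolP.
  case: (ex_minnP ex) => m /andP[m0 /asboolP[w Sw]] mmin {n n0 exw ex}.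
  have [z zm] : exists z, z ^+ m = w.
    have [z] := @solve_monicpoly R[i] m (fun i => if i == 0%N then w else 0) m0.
    move=> zm; exists z; rewrite zm (bigD1 (Ordinal m0))//= expr0 mulr1.
    by rewrite big1 ?addr0// => -[[|i] ?]//= _; rewrite mul0r.
  have z1 : `|z| = 1.
    have /eqP := S1 _ Sw; rewrite /= -zm normrX => /eqP zm1.
    by apply/eqP; rewrite -(@pexpr_eq1 _ _ m)// zm1.
  exists z; split => // k y Sy.
  have z0 : z != 0 by rewrite -normr_eq0 z1 oner_eq0.
  have m0z : m%:Z != 0 by rewrite eqz_nat -lt0n.
  have Sr : S (g *~ (k %% m)%Z, y / w ^ (k %/ m)%Z).
    have /= := SB _ _ Sy (partial_characterXz (k %/ m)%Z hS Sw).
    congr (S (_, _)); rewrite {1}(divz_eq k m) mulrzDr mulrC mulrzA.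
    by rewrite -pmulrn addrAC subrr add0r.
  have rge0 := modz_ge0 k m0z; have := ltz_pmod k (m0 : 0 < m%:Z).
  case: (k %% m)%Z rge0 (divz_eq k m) Sr => // r _ ek Sr rm.
  have r0 : r = 0%N.
    apply/eqP; rewrite -leqn0 leqNgt; apply/negP => rpos.
    have := mmin r; rewrite rpos /=.
    move: rm; rewrite ltz_nat ltnNge => /negP nm /(_ _)/nm; apply.
    by apply/asboolP; exists (y / w ^ (k %/ m)%Z).
  move: Sr; rewrite r0 mulr0z => /S0/divr1_eq ->.
  by rewrite {2}ek r0 addr0 mulrC -exprz_exp -exprnP zm.
- exists 1; split=> [|k w]; first by rewrite normr1.
  rewrite exp1rz; case: k => [[|n]|n]; first by rewrite mulr0z => /S0.
    by move=> Sw; exfalso; apply: nex; exists n.+1 => //; exists w.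
  move=> Sw; exfalso; apply: nex; exists n.+1 => //; exists w^-1.
  by have := SB _ _ S01 Sw; rewrite /= NegzE mulrNz opprK add0r div1r.
Qed.

(** Zorn: a maximal partial character is defined everywhere, by the one-step
    extension. *)
Lemma partial_character_total S : partial_character S ->
  exists2 chi : Gam -> R[i], unitary_character chi &
    forall g z, S (g, z) -> chi g = z.
Proof.
move=> hS.
have [|A [hA maxA]] :=
    @Zorn_bigcup _ [set A | partial_character (A `|` S)].
  move=> F FP Ftot; rewrite /=; set U := _ `|` S.
  have SU : S `<=` U by move=> p; right.
  have FU A : F A -> A `|` S `<=` U.
    by move=> FA p [Ap|Sp]; [left; exists A|right].
  have two p q : U p -> U q ->
      exists T, [/\ partial_character T, T `<=` U, T p & T q].
    move=> [[A FA Ap]|Sp] [[B FB Bq]|Sq].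
    - have [AB|BA] := Ftot _ _ FA FB.
        by exists (B `|` S); split; [exact: FP|exact: FU|left; exact: AB|left].
      by exists (A `|` S); split; [exact: FP|exact: FU|left|left; exact: BA].
    - by exists (A `|` S); split; [exact: FP|exact: FU|left|right].
    - by exists (B `|` S); split; [exact: FP|exact: FU|right|left].
    - by exists S.
  split.
  - by apply: SU; case: hS.
  - move=> p q Up Uq; have [T [[_ TB _ _] TU Tp Tq]] := two _ _ Up Uq.
    exact/TU/TB.
  - by move=> p Up; have [T [[_ _ T1 _] _ Tp _]] := two _ _ Up Up; exact: T1.
  - by move=> z Uz; have [T [[_ _ _ T0] _ Tz _]] := two _ _ Uz Uz; exact: T0.
have dom g : exists z, (A `|` S) (g, z).
  apply: contrapT => ng; have [S' [hS' AS' [z S'z]]] := partial_character_step g hA.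
  apply: (maxA S').
    split=> [|S'A]; first by move=> p Ap; apply: AS'; left.
    by apply: ng; exists z; left; exact: S'A.
  rewrite /= (_ : S' `|` S = S')//; apply/setUidPl => p Sp.
  by apply: AS'; right.
have [chi hchi] := choice dom; have [T1 TB Tn T0] := hA.
exists chi; last first.
  by move=> g z Sz; apply: partial_character_fun hA (hchi g) _; right.
split=> [t|s t]; first exact: (Tn _ (hchi t)).
apply: partial_character_fun hA (hchi _) _.
have := TB _ _ (hchi s) (TB _ _ T1 (hchi t)).
by rewrite /= sub0r opprK div1r invrK.
Qed.

(** Characters separate the points of [Gam] by roots of unity: [chi d] may be
    taken to be [-1] if [d] has infinite order, and otherwise a nontrivial root
    of unity whose exponent is the order of [d]. *)
Lemma character_root_of_unity (d : Gam) : d != 0 ->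
  exists2 chi : Gam -> R[i], unitary_character chi &
    exists2 N, (0 < N)%N & chi d != 1 /\ chi d ^+ N = 1.
Proof.
move=> d0; pose S : set (Gam * R[i]) := [set (0, 1)].
have hS : partial_character S.
  split=> //; first by move=> _ _ -> ->; rewrite /S /= subrr divr1.
    by move=> _ ->; rewrite /= normr1.
  by move=> z [].
suff [z [z1 zk [N N0 zN]]] : exists z : R[i], [/\ z != 1,
    forall k : int, d *~ k = 0 -> 1 = z ^ k & exists2 N, (0 < N)%N & z ^+ N = 1].
  have nz : `|z| = 1.
    by apply/eqP; rewrite -(@pexpr_eq1 _ _ N)// -normrX zN normr1.
  have hz (k : int) w : S (d *~ k, w) -> w = z ^ k by move=> [/zk <- ->].
  have [S' [hS' _ S'd]] := extend_partial_character hS nz hz.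
  have [chi hchi chiE] := partial_character_total hS'.
  by exists chi => //; exists N => //; rewrite (chiE _ _ S'd).
have [[n0 n00 dn0]|inf] := pselect (exists2 n, (0 < n)%N & d *+ n = 0); last first.
  exists (-1); split.
    by rewrite eqr_oppLR -subr_eq0 opprK (_ : 1 + 1 = 2%:R)// pnatr_eq0.
    case=> [[|n]|n] //= hk; exfalso; apply: inf; exists n.+1 => //.
    by apply/eqP; rewrite -oppr_eq0; apply/eqP; move: hk; rewrite NegzE mulrNz.
  by exists 2%N => //; rewrite sqrrN expr1n.
have ex : exists n, (0 < n)%N && (d *+ n == 0) by exists n0; rewrite n00 dn0 eqxx.
case: (ex_minnP ex) => n /andP[npos /eqP dn] nmin {n0 n00 dn0 ex}.
have n1 : (1 < n)%N.
  by rewrite ltn_neqAle npos andbT; apply: contraNneq d0 => n1; rewrite -dn -n1.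
have n1' : (0 < n.-1)%N by rewrite -subn1 subn_gt0.
have [z hz] := @solve_monicpoly R[i] n.-1 (fun=> -1) n1'.
have sz : \sum_(i < n) z ^+ i = 0.
  rewrite -(prednK npos) big_ord_recr /= hz -big_split big1//= => i _.
  by rewrite mulN1r subrr.
have zn : z ^+ n = 1.
  by apply/eqP; rewrite -subr_eq0 subrX1 sz mulr0.
exists z; split; last by exists n.
  apply/eqP => z1; move/eqP: sz; rewrite z1 (eq_bigr (fun=> 1)).
    by rewrite sumr_const card_ord pnatr_eq0 => /eqP n0; rewrite n0 in npos.
  by move=> i _; rewrite expr1n.
have nz : n%:Z != 0 by rewrite eqz_nat -lt0n.
move=> k dk; have := ltz_pmod k (npos : 0 < n%:Z).
have := divz_eq k n; case: (k %% n)%Z (modz_ge0 k nz) => // r _ ek rn.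
have r0 : r = 0%N.
  apply/eqP; rewrite -leqn0 leqNgt; apply/negP => rpos.
  have := nmin r; rewrite rpos /=; move: rn; rewrite ltz_nat ltnNge => /negP nr.
  move=> /(_ _)/nr; apply; apply/eqP.
  by rewrite -dk ek mulrzDr mulrC mulrzA -!pmulrn dn mul0rz add0r.
by rewrite ek r0 addr0 mulrC -exprz_exp -exprnP zn exp1rz.
Qed.

End Characters.
(** * Compactness and compact open sets *)

Section CompactInduction.
Variable T : topologicalType.
Implicit Types (A B K : set T) (x : T).

(** Finite subcovers as an induction principle. If [Q K] failed, the sets [A]
    with [Q (K `\` A)] would form a proper filter on [K], and a cluster point of
    it would have no neighbourhood satisfying [Q]. *)
Lemma compact_ind K (Q : set T -> Prop) :
  compact K -> Q set0 -> (forall A B, B `<=` A -> Q A -> Q B) ->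
  (forall A B, Q A -> Q B -> Q (A `|` B)) ->
  (forall x, K x -> exists2 A, nbhs x A & Q A) -> Q K.
Proof.
move=> cK Q0 Qsub QU Qloc; apply: contrapT => nQK.
pose F : set_system T := [set A | Q (K `\` A)].
have FF : Filter F.
  split.
  - by rewrite /F /= setDT.
  - move=> A B FA FB; apply: Qsub (QU _ _ FA FB) => x [Kx nAB].
    by have [Ax|nAx] := pselect (A x); [right; split=> // Bx; exact: nAB|left].
  - by move=> A B AB; apply: Qsub => x [Kx nB]; split=> // /AB.
have PF : ProperFilter F by split=> //; rewrite /F /= setD0.
have FK : F K by rewrite /F /= setDv.
have [x [Kx clx]] := cK F PF FK; have [A nA QA] := Qloc x Kx.
have FnA : F (~` A) by apply: Qsub QA => y [_ /contrapT].
by have [y []] := clx _ _ FnA nA.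
Qed.

End CompactInduction.

Section ZeroDimensional.
Variable T : topologicalType.
Implicit Types (A B K O : set T) (x : T).

(** In a compact Hausdorff space the intersection of the clopen neighbourhoods
    of a point is connected; so it is the point itself when the connected
    components are trivial, and by compactness the clopen neighbourhoods then
    form a base. The argument is run inside a compact neighbourhood [L] of [x],
    clopen meaning closed and relatively open in [L]. *)
Lemma totally_disconnected_compact_open B O x :
  hausdorff_space T -> locally_compact [set: T] -> open B ->
  totally_disconnected B -> open O -> O x -> B x ->
  exists W, [/\ compact W, open W, W x & W `<=` O `&` B].
Proof.
move=> hT lcT oB tdB oO Ox Bx.
have [K cK nK] : exists2 K, compact K & nbhs x K.
  have [K nK [cK _]] := lcT x I; exists K => //.
  have nK' : nbhs x [set y | [set: T] y -> K y] := nK.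
  by apply: filterS nK' => y /(_ I).
have [L0 nL0 clL0] : exists2 L0, nbhs x L0 & closure L0 `<=` K° `&` B `&` O.
  apply: (compact_regular hT cK nK).
  apply: filterI; first apply: filterI.
  - exact: nbhs_interior.
  - exact: open_nbhs_nbhs.
  - exact: open_nbhs_nbhs.
set L := closure L0 in clL0; have cL : closed L by exact: closed_closure.
have nL : nbhs x L by apply: filterS nL0; exact: subset_closure.
have LK : L `<=` K by move=> y /clL0[[/interior_subset]].
have LKi : L `<=` K° by move=> y /clL0[[]].
pose F := [set C |
  [/\ closed C, C x, C `<=` L & exists2 E, open E & C = L `&` E]].
have FL : F L.
  by split=> //; [exact: nbhs_singleton|exists setT; [exact: openT|rewrite setIT]].
have FI C D : F C -> F D -> F (C `&` D).
  move=> [c1 x1 s1 [E1 o1 e1]] [c2 x2 s2 [E2 o2 e2]]; split=> //.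
  - exact: closedI.
  - by move=> y [/s1].
  - by exists (E1 `&` E2); [exact: openI|rewrite e1 e2 setIACA setIid].
pose Q := \bigcap_(C in F) C.
have Qx : Q x by move=> C [].
have cQ : closed Q by apply: closed_bigI => C [].
have QL : Q `<=` L by move=> y; apply.
have near A : open A -> Q `<=` A -> exists2 C, F C & C `<=` A.
  move=> oA QA; have cLA : compact (L `\` A).
    apply: subclosed_compact cK _ => [|y [/LK]//].
    by apply: closedI => //; exact: open_closedC.
  suff [C FC CA] : exists2 C, F C & C `&` (L `\` A) `<=` set0.
    exists C => // y Cy; apply: contrapT => nAy; apply: (CA y).
    by split=> //; split=> //; case: FC => _ _ + _; apply.
  apply: (compact_ind (Q := fun S => exists2 C, F C & C `&` S `<=` set0) cLA).
  - by exists L => // y [].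
  - by move=> S S' S'S [C FC CS]; exists C => // y [Cy /S'S Sy]; exact: (CS y).
  - move=> S S' [C FC CS] [C' FC' CS']; exists (C `&` C'); first exact: FI.
    by move=> y [[Cy C'y] [Sy|S'y]]; [apply: (CS y)|apply: (CS' y)].
  - move=> y [Ly nAy]; have : ~ Q y by move/QA.
    move=> /existsNP[C /not_implyP[FC nCy]]; exists (~` C); last by exists C => // z [].
    by apply: open_nbhs_nbhs; split=> //; apply: closed_openC; case: FC.
suff Q1 : Q `<=` [set x].
  (* a member of [F] inside the interior of [L] is open in the whole space *)
  have [||C [cC Cx CL [E oE CE]] CO] := near L°; first exact: open_interior.
    by move=> y /Q1 ->.
  exists C; split=> //; last by move=> y /CL/clL0[[]].
    by apply: subclosed_compact cK _ => // y /CL/LK.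
  suff -> : C = L° `&` E by apply: openI => //; exact: open_interior.
  apply/seteqP; split=> [y Cy|y [/interior_subset Ly Ey]]; last by rewrite CE.
  by split; [exact: CO|move: Cy; rewrite CE => -[]].
suff conQ : connected Q.
  rewrite -(tdB _ Bx); apply: connected_component_max => // y /QL/clL0[[]//].
move=> S [y0 Sy0] [C oC SC] [D cD SD].
have cS : closed S by rewrite SD; exact: closedI.
have [S' nS' clS'] : exists2 S', set_nbhs S S' & closure S' `<=` ~` (Q `\` S).
  apply: (compact_normal_local hT cK) => //.
    by move=> y Sy; apply: LKi; apply: QL; move: Sy; rewrite SC => -[].
  apply/set_nbhsP; exists (~` (Q `\` C)); split.
  - by apply: closed_openC; apply: closedI => //; exact: open_closedC.
  - by rewrite SC => y [Qy Cy] [].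
  - by move=> y nQC [Qy nSy]; apply: nQC; split=> // Cy; apply: nSy; rewrite SC.
(* [U] and the complement of [closure S'] separate [S] from [Q `\` S]; a member
   of [F] inside their union is cut by them into two clopen pieces, and the one
   containing [x] is again in [F] *)
have [U [oU SU US']] := (set_nbhsP _ _).1 nS'.
have QUV : Q `<=` U `|` ~` closure S'.
  move=> y Qy; have [Sy|nSy] := pselect (S y); first by left; exact: SU.
  by right=> /clS'; apply.
have [A [cA Ax AL [E oE AE]] AUV] :=
  near _ (openU oU (closed_openC (@closed_closure _ S'))) QUV.
have USc : U `<=` closure S' by move=> y /US'; exact: subset_closure.
have [Sx|nSx] := pselect (S x).
  have AUe : A `&` U = A `&` closure S'.
    apply/seteqP; split=> y [Ay Uy]; split=> //; first exact: USc.
    by case: (AUV y Ay).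
  have FA : F (A `&` U).
    split=> //.
    - by rewrite AUe; apply: closedI => //; exact: closed_closure.
    - by split=> //; exact: SU.
    - by move=> y [/AL].
    - by exists (E `&` U); [exact: openI|rewrite AE setIA].
  apply/seteqP; split=> [y|y Qy]; first by rewrite SC => -[].
  apply: contrapT => nSy; have [_ /USc/clS'] := Qy _ FA; exact.
have FA : F (A `&` ~` closure S').
  have AUe : A `&` ~` closure S' = A `&` ~` U.
    apply/seteqP; split=> y [Ay Uy]; split=> //; first by move/USc.
    by case: (AUV y Ay).
  split=> //.
  - by rewrite AUe; apply: closedI => //; exact: open_closedC.
  - by split=> // /clS'; apply.
  - by move=> y [/AL].
  - exists (E `&` ~` closure S'); last by rewrite AE setIA.
    by apply: openI => //; apply: closed_openC; exact: closed_closure.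
have Qy0 : Q y0 by move: Sy0; rewrite SC => -[].
by have [_ []] := Qy0 _ FA; apply/USc/SU.
Qed.

End ZeroDimensional.
(** * Groupoids and etale topology *)

Section LocalHomeomorphism.
Variables (X Y : topologicalType) (f : X -> Y) (B : set Y).
Hypothesis lf : local_homeomorphism f B.

Lemma local_homeo_continuous : continuous f.
Proof.
move=> x; have [_ /(_ x)[U [oU Ux _ cU _]]] := lf.
by move: cU; rewrite continuous_open_subspace// => /(_ x); apply; rewrite inE.
Qed.

Lemma local_homeo_locally_injective x :
  exists U, [/\ open U, U x & {in U &, injective f}].
Proof.
have [_ /(_ x)[U [oU Ux _ _ [g gf _]]]] := lf; exists U; split=> //.
by move=> y z /set_mem Uy /set_mem Uz e; rewrite -(gf y Uy) -(gf z Uz) e.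
Qed.

Lemma local_homeo_open_map (A : set X) : open B -> open A -> open (f @` A).
Proof.
move=> oB oA; rewrite openE => _ [x Ax <-].
have [_ /(_ x)[U [oU Ux [W oW fU] _ [g gf cg]]]] := lf.
have oZ : open (f @` U) by rewrite fU; exact: openI.
rewrite continuous_open_subspace// in cg.
have oV := (continuous_inP g oZ).1 cg _ oA.
rewrite /interior; apply: filterS (open_nbhs_nbhs (conj oV _)).
  by move=> _ [[y Uy <-]]; rewrite /= gf// => Ay; exists y.
by split; [exists x|rewrite /= gf].
Qed.

(** The local section carries compact sets to compact sets; [A'] is the part of
    [A] on which it is defined. *)
Lemma local_homeo_compact_lift (A : set X) : open B -> open A ->
  forall x, A x -> exists A' : set X, [/\ open A', A' `<=` A, A' x &
    forall W, compact W -> W `<=` f @` A' -> compact (A' `&` f @^-1` W)].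
Proof.
move=> oB oA x Ax; have [_ /(_ x)[U [oU Ux [W oW fU] _ [g gf cg]]]] := lf.
exists (U `&` A); split; [exact: openI|by move=> y []|by []|].
move=> Z cZ ZUA; rewrite (_ : _ `&` _ = g @` Z).
  apply: continuous_compact => //; apply: continuous_subspaceW cg.
  by move=> z /ZUA[y [Uy _] <-]; exists y.
apply/seteqP; split=> [y [[Uy Ay] Zfy]|_ [z Zz <-]]; first by exists (f y); rewrite ?gf.
by have [y [Uy Ay] e] := ZUA z Zz; rewrite -e gf//; split=> //=; rewrite e.
Qed.

End LocalHomeomorphism.

Section GroupoidAlgebra.
Variables (G : topologicalType) (Gr : groupoid G).
Implicit Types (g h x : G).
Local Notation src := (Defs.src Gr).
Local Notation rng := (Defs.rng Gr).
Local Notation inv := (Defs.inv Gr).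
Local Notation mul := (Defs.mul Gr).

Lemma unit_src g : units Gr g -> src g = g.
Proof. by move=> [h _ <-]; exact: src_src. Qed.

Lemma unit_rng g : units Gr g -> rng g = g.
Proof. by move=> [h _ <-]; exact: rng_src. Qed.

Lemma src_unit g : units Gr (src g). Proof. by exists g. Qed.

Lemma rng_unit g : units Gr (rng g).
Proof. by exists (rng g) => //; exact: src_rng. Qed.

Lemma inv_unit g : units Gr g -> inv g = g.
Proof.
move=> ug; have := mul_src Gr (inv g).
by rewrite src_inv unit_rng// => <-; rewrite inv_mul unit_src.
Qed.

Lemma divK x h : src x = src h -> mul (mul x (inv h)) h = x.
Proof.
by move=> e; rewrite -mul_assoc ?rng_inv ?src_inv// inv_mul -e mul_src.
Qed.

Lemma src_div x h : src x = src h -> src (mul x (inv h)) = rng h.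
Proof. by move=> e; rewrite src_mul ?rng_inv// src_inv. Qed.

Lemma rng_div x h : src x = src h -> rng (mul x (inv h)) = rng x.
Proof. by move=> e; rewrite rng_mul ?rng_inv. Qed.

Lemma div_src x : mul x (inv (src x)) = x.
Proof. by rewrite (inv_unit (src_unit x)) mul_src. Qed.

(** [x h^-1] is a unit only if [x = h]: this turns convolution with a function
    supported on the units into a pointwise product. *)
Lemma div_unit x h : src x = src h -> units Gr (mul x (inv h)) -> x = h.
Proof.
move=> e u; rewrite -[LHS](divK e) -(unit_src u) src_div//.
exact: rng_mull.
Qed.

Lemma div_inj x h k : src x = src h -> src x = src k ->
  mul x (inv h) = mul x (inv k) -> h = k.
Proof.
move=> xh xk e; have rhk : rng h = rng k by rewrite -(src_div xh) e src_div.
have divI a : src x = src a -> mul (inv (mul x (inv a))) x = a.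
  move=> xa; rewrite -{2}(divK xa) mul_assoc ?src_inv ?src_div//.
  by rewrite inv_mul src_div// rng_mull.
by rewrite -(divI h)// e divI.
Qed.

(** A pair [(r, s)] determines the arrow inside each level set of the cocycle
    as soon as its kernel is principal. *)
Lemma cocycle_level_injective (Gam : zmodType) (c : G -> Gam) g h :
  cocycle Gr c -> principal_on Gr (c @^-1` [set 0]) ->
  c g = c h -> src g = src h -> rng g = rng h -> g = h.
Proof.
move=> [_ cM] pr cgh sgh rgh.
have cu u : units Gr u -> c u = 0.
  move=> uu; apply: (addrI (c u)); rewrite addr0 -cM ?unit_src ?unit_rng//.
  by rewrite -{2}(unit_src uu) mul_src.
apply: div_unit => //; apply: pr; last by rewrite src_div// rng_div// rgh.
have e : src g = rng (inv h) by rewrite rng_inv.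
have := cM h (inv h); rewrite rng_inv mul_inv => /(_ erefl).
by rewrite (cu _ (rng_unit h)) /= cM// cgh => <-.
Qed.

End GroupoidAlgebra.

Section EtaleTopology.
Variables (G : topologicalType) (Gr : groupoid G).
Hypothesis eG : etale Gr.
Implicit Types (A B K O V W : set G) (g h x : G).
Local Notation src := (Defs.src Gr).
Local Notation rng := (Defs.rng Gr).

Lemma etale_hausdorff : hausdorff_space G.
Proof. by case: eG. Qed.

Lemma src_continuous : continuous src.
Proof. by have [_ _ _ _ [/local_homeo_continuous]] := eG. Qed.

Lemma rng_continuous : continuous rng.
Proof. by have [_ _ _ _ [_ /local_homeo_continuous]] := eG. Qed.

(** Near a unit [u], an arrow [g] is close to [src g]; as [src] takes the same
    value at both, local injectivity makes [g] a unit. *)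
Lemma units_open : open (units Gr).
Proof.
rewrite openE => u uu; have [_ _ _ _ [ls _]] := eG.
have [U [oU Uu injU]] := local_homeo_locally_injective ls u.
have oV : open (U `&` src @^-1` U).
  by apply: openI => //; move/continuousP: src_continuous; apply.
apply: filterS (open_nbhs_nbhs (conj oV _)).
  move=> g [Ug Usg]; exists (src g) => //.
  by apply: injU; rewrite ?src_src ?inE.
by split=> //=; rewrite unit_src.
Qed.

Lemma units_closed : closed (units Gr).
Proof.
move=> g clg; exists g => //; apply: etale_hausdorff => A B nA nB.
have nS : nbhs g (src @^-1` A `&` B).
  apply: filterI nB.
  by apply: src_continuous.
have [u [uu [Au Bu]]] := clg _ nS.
by exists u; split=> //; rewrite -(unit_src uu).
Qed.

Lemma src_open_map A : open A -> open (src @` A).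
Proof.
by have [_ _ _ _ [ls _]] := eG; exact: local_homeo_open_map ls _ units_open.
Qed.

Lemma rng_open_map A : open A -> open (rng @` A).
Proof.
by have [_ _ _ _ [_ lr]] := eG; exact: local_homeo_open_map lr _ units_open.
Qed.

Hypothesis tdG : totally_disconnected (units Gr).

(** Compact open sets of units lift through a local section of the source map. *)
Lemma compact_open_bisection_base O g : open O -> O g ->
  exists V, [/\ compact V, open V, V g, V `<=` O & bisection Gr V].
Proof.
move=> oO Og; have [_ lcG hG _ [ls lr]] := eG.
have [U1 [oU1 U1g inj1]] := local_homeo_locally_injective ls g.
have [U2 [oU2 U2g inj2]] := local_homeo_locally_injective lr g.
have [|A [oA AO Ag liftA]] :=
  local_homeo_compact_lift ls units_open (openI oO (openI oU1 oU2)) (x := g).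
  by [].
have [|W [cW oW Wg WA]] := totally_disconnected_compact_open hG lcG units_open
  tdG (src_open_map oA) _ (src_unit Gr g).
  by exists g.
exists (A `&` src @^-1` W); split.
- by apply: liftA => // y /WA[].
- by apply: openI => //; move/continuousP: src_continuous; apply.
- by [].
- by move=> y [/AO[]].
- split=> y z /set_mem[/AO[_ [U1y U2y]] _] /set_mem[/AO[_ [U1z U2z]] _].
    by apply: inj1; rewrite inE.
  by apply: inj2; rewrite inE.
Qed.

End EtaleTopology.
(** * Compactly supported functions *)

Section ComplexTopology.
Variable R : realType.
Implicit Types (z w : R[i]) (e : R).
Local Notation normc := (@Normc.normc R).

Lemma normr_normc z : `|z| = (normc z)%:C.
Proof. by case: z. Qed.

Lemma normc_ge0 z : 0 <= normc z.
Proof. by have := normr_ge0 z; rewrite normr_normc ler0c. Qed.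

Lemma normc_eq1 z : `|z| = 1 -> normc z = 1.
Proof. by rewrite normr_normc => /(congr1 (@complex.Re R)). Qed.

Lemma normcD z w : normc (z + w) <= normc z + normc w.
Proof. by have := ler_normD z w; rewrite !normr_normc -rmorphD lecR. Qed.

Lemma normcN z : normc (- z) = normc z.
Proof. by have := normrN z; rewrite !normr_normc => /(congr1 (@complex.Re R)). Qed.

Lemma normcB z w : normc (z - w) = normc (w - z).
Proof. by rewrite -opprB normcN. Qed.

Lemma normc_sum (I : Type) (r : seq I) (P : pred I) (F : I -> R[i]) :
  normc (\sum_(i <- r | P i) F i) <= \sum_(i <- r | P i) normc (F i).
Proof.
elim/big_ind2: _ => [|x a y b xa yb|//]; first by rewrite Normc.normc0.
exact: le_trans (normcD _ _) (lerD xa yb).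
Qed.

(** The norm of [R[i]] is complex valued; neighbourhoods are described by real
    radii instead. *)
Lemma nbhs_complexP z (A : set R[i]) :
  nbhs z A <-> exists2 e, 0 < e & forall w, normc (w - z) < e -> A w.
Proof.
split=> [/nbhs_ballP[e e0 eA]|[e e0 eA]].
  have er : e = (complex.Re e)%:C by apply/esym/RRe_real/gtr0_real.
  exists (complex.Re e); first by move: e0; rewrite /= {1}er -[0 : R[i]]/(0%:C) ltcR.
  by move=> w wz; apply: eA; rewrite -ball_normE /ball_/= er normr_normc ltcR normcB.
apply/nbhs_ballP; exists e%:C; first by rewrite /= -[0 : R[i]]/(0%:C) ltcR.
move=> w; rewrite -ball_normE /ball_/= normr_normc ltcR normcB; exact: eA.
Qed.

Lemma cvg_uniform_normc (T : choiceType) (f_ : nat -> T -> R[i]) (a : T -> R[i]) :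
  {uniform, f_ n @[n --> \oo] --> a} <->
  forall e, 0 < e -> \forall n \near \oo, forall x, normc (f_ n x - a x) < e.
Proof.
split=> [fa e e0|fa A].
  have := fa [set g | forall x, normc (g x - a x) < e]; apply.
  apply/uniform_nbhs; exists [set p | normc (p.2 - p.1) < e].
  split; last by move=> g h x; apply: h.
  rewrite -entourage_ballE; exists e%:C; first by rewrite /= -[0 : R[i]]/(0%:C) ltcR.
  by move=> [z w] /=; rewrite -ball_normE /ball_/= normr_normc ltcR normcB.
move=> /uniform_nbhs[E [+ EA]]; rewrite -entourage_ballE => -[e e0 eE].
have er : e = (complex.Re e)%:C by apply/esym/RRe_real/gtr0_real.
have e0' : 0 < complex.Re e by move: e0; rewrite /= {1}er -[0 : R[i]]/(0%:C) ltcR.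
apply: filterS (fa _ e0') => n fn; apply: EA => x _; apply: eE => /=.
by rewrite -ball_normE /ball_/= er normr_normc ltcR normcB.
Qed.

End ComplexTopology.

Section CompactSupport.
Variables (R : realType) (G : topologicalType).
Implicit Types (f m : G -> R[i]) (P A B V K : set G).
Local Notation normc := (@Normc.normc R).

Lemma near_normc f x (e : R) : continuous f -> 0 < e ->
  nbhs x [set y | normc (f y - f x) < e].
Proof.
move=> cf e0.
have nx : nbhs (f x) [set w | normc (w - f x) < e] by apply/nbhs_complexP; exists e.
exact: (cf x _ nx).
Qed.

Lemma continuous_pmul f m : continuous f -> continuous m -> continuous (m \* f).
Proof. by move=> cf cm x; exact (cvgM (cm x) (cf x)). Qed.

Lemma continuous_padd f m : continuous f -> continuous m -> continuous (f \+ m).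
Proof. by move=> cf cm x; exact (cvgD (cf x) (cm x)). Qed.

Lemma continuous_indicator A : open A -> closed A -> continuous (\1_A : G -> R[i]).
Proof.
move=> oA cA x B nB.
have [Ax|nAx] := pselect (A x).
  apply: filterS (open_nbhs_nbhs (conj oA Ax)) => y Ay /=.
  by move: (nbhs_singleton nB); rewrite !indicE !mem_set.
apply: filterS (open_nbhs_nbhs (conj (closed_openC cA) nAx)) => y nAy /=.
by move: (nbhs_singleton nB); rewrite !indicE !memNset.
Qed.

Lemma Cc_mul P f m : Cc P f -> continuous m -> Cc P (m \* f).
Proof.
move=> [cf kf sf] cm.
have sub : closure [set g | (m \* f) g != 0] `<=` closure [set g | f g != 0].
  by apply: closure_subset => g /=; rewrite mulf_eq0 negb_or => /andP[].
split; first exact (continuous_pmul cf cm).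
  exact: subclosed_compact (@closed_closure _ _) kf sub.
exact: subset_trans sub sf.
Qed.

Lemma Cc_add P f m : Cc P f -> Cc P m -> Cc P (f \+ m).
Proof.
move=> [cf kf sf] [cm km sm].
have sub : closure [set g | (f \+ m) g != 0] `<=`
    closure [set g | f g != 0] `|` closure [set g | m g != 0].
  rewrite -closureU; apply: closure_subset => g /=.
  have [->|] := eqVneq (f g) 0; last by left.
  by rewrite add0r; right.
split; first exact (continuous_padd cf cm).
  by apply: subclosed_compact (@closed_closure _ _) _ sub; exact: compactU.
by apply: subset_trans sub _ => g [/sf|/sm].
Qed.

Lemma Cc_sub P f m : Cc P f -> Cc P m -> Cc P (f \- m).
Proof.
move=> Pf Pm; rewrite (_ : f \- m = f \+ (cst (-1) \* m)).
  by apply: (Cc_add Pf); apply: (Cc_mul Pm) => x; exact: cvg_cst.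
by apply/funext => x /=; rewrite mulN1r.
Qed.

Lemma Cc_of_compact V P f : hausdorff_space G -> compact V -> V `<=` P ->
  continuous f -> (forall x, ~ V x -> f x = 0) -> Cc P f.
Proof.
move=> hG cV VP cf f0; have sub : closure [set g | f g != 0] `<=` V.
  rewrite [V in _ `<=` V](closure_id _).1; last exact: compact_closed.
  apply: closure_subset => g /= /eqP fg.
  by apply: contrapT => /f0.
split=> //; last exact: subset_trans sub VP.
exact: subclosed_compact (@closed_closure _ _) cV sub.
Qed.

Lemma Cc_bounded P f : Cc P f ->
  exists2 B : R, 0 <= B & forall x, normc (f x) <= B.
Proof.
move=> [cf kf _].
have [B B0 hB] : exists2 B : R, 0 <= B &
    forall x, closure [set g | f g != 0] x -> normc (f x) <= B.
  apply: (compact_ind (Q := fun A => exists2 B : R, 0 <= B &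
    forall x, A x -> normc (f x) <= B) kf).
  - by exists 0.
  - by move=> A A' AA' [B B0 hB]; exists B => // x /AA'; exact: hB.
  - move=> A A' [B B0 hB] [B' B'0 hB']; exists (B + B'); first exact: addr_ge0.
    by move=> x [/hB|/hB'] h; apply: le_trans h _; rewrite ?lerDl ?lerDr.
  - move=> x _; exists [set y | normc (f y - f x) < 1].
      exact: near_normc.
    exists (1 + normc (f x)); first by rewrite addr_ge0// normc_ge0.
    move=> y /= fyx; rewrite -[f y](subrK (f x)).
    by apply: le_trans (normcD _ _) _; rewrite lerD2r ltW.
exists B => // x; have [->|fx] := eqVneq (f x) 0; first by rewrite Normc.normc0.
by apply: hB; exact: subset_closure.
Qed.

(** Where compact open sets form a base, a partition of unity is obtained by
    cutting a function with indicators. *)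
Lemma Cc_ind P (Q : (G -> R[i]) -> Prop) : hausdorff_space G ->
  Q (fun=> 0) -> (forall f m, Q f -> Q m -> Q (f \+ m)) ->
  (forall x, P x -> exists V, [/\ compact V, open V, V x &
     forall f, continuous f -> (forall y, ~ V y -> f y = 0) -> Q f]) ->
  forall f, Cc P f -> Q f.
Proof.
move=> hG Q0 QD Qloc f [cf kf sf].
pose good A := forall f, continuous f -> (forall y, ~ A y -> f y = 0) -> Q f.
suff [A [_ _ KA gA]] : exists A, [/\ open A, closed A,
    closure [set g | f g != 0] `<=` A & good A].
  apply: gA => // y nAy; apply: contrapT => /eqP fy; apply/nAy/KA.
  exact: subset_closure.
apply: (compact_ind (Q := fun S => exists A,
    [/\ open A, closed A, S `<=` A & good A]) kf).
- exists set0; split=> //; first exact: open0.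
    exact: closed0.
  move=> h _ h0; rewrite (_ : h = fun=> 0)//.
  by apply/funext => y; exact: h0.
- by move=> S S' S'S [A [oA cA SA gA]]; exists A; split=> // y /S'S /SA.
- move=> S S' [A [oA cA SA gA]] [A' [oA' cA' SA' gA']].
  exists (A `|` A'); split; [exact: openU|exact: closedU|exact: setUSS|].
  move=> h ch h0; rewrite (_ : h = (\1_A \* h) \+ (\1_(~` A) \* h)).
    apply: QD.
      apply: gA => [|y nAy]; last by rewrite /= indicE memNset// mul0r.
      exact (continuous_pmul ch (continuous_indicator oA cA)).
    apply: gA' => [|y nAy].
      exact (continuous_pmul ch
        (continuous_indicator (closed_openC cA) (open_closedC oA))).
    rewrite /= indicE; have [Ay|nA] := pselect (A y).
      by rewrite memNset ?mul0r//; apply.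
    by rewrite h0 ?mulr0// => -[].
  apply/funext => y; rewrite /= !indicE in_setC.
  by case: (y \in A); rewrite /= ?mul1r ?mul0r ?addr0 ?add0r.
- move=> x /sf/Qloc[V [cV oV Vx gV]]; exists V; first exact: open_nbhs_nbhs.
  by exists V; split=> //; exact: compact_closed.
Qed.

End CompactSupport.
(** * Operator bounds through finite matrix forms *)

Section OperatorBound.
Variables (R : realType) (G : topologicalType) (Gr : groupoid G).
Implicit Types (f m p q xi eta : G -> R[i]) (X H : {fset G}) (C D B : R).
Local Notation src := (Defs.src Gr).
Local Notation rng := (Defs.rng Gr).
Local Notation inv := (Defs.inv Gr).
Local Notation mul := (Defs.mul Gr).
Local Notation normc := (@Normc.normc R).

Definition in_fiber u X := forall x, x \in X -> src x = u.

(** The matrix of [Ind u f], with entries [f (x h^-1)], evaluated at test vectors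
    supported on the finite sets [H] and [X]. *)
Definition matrix_form f X H xi eta : R[i] :=
  \sum_(x <- X) \sum_(h <- H) f (mul x (inv h)) * xi h * eta x.

Definition sqsum X xi : R := \sum_(x <- X) normc (xi x) ^+ 2.

(** The operators [Ind u f] have norm at most [C]. Bounding a form by the mean of
    the squared norms is equivalent, by scaling the test vectors, to bounding it
    by the product of the norms; the mean needs no square root and is additive
    over orthogonal blocks. Only finite sums occur, so the bound makes sense for
    every function, and in particular for the elements of the completion. *)
Definition opbound f C : Prop := forall u X H xi eta,
  in_fiber u X -> in_fiber u H ->
  normc (matrix_form f X H xi eta) <= C / 2 * (sqsum H xi + sqsum X eta).

Lemma sqsum_ge0 X xi : 0 <= sqsum X xi.
Proof. by apply: sumr_ge0 => x _; exact: sqr_ge0. Qed.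

Lemma sqsumZ X xi z : sqsum X (fun h => z * xi h) = normc z ^+ 2 * sqsum X xi.
Proof.
by rewrite /sqsum mulr_sumr; apply: eq_bigr => x _; rewrite Normc.normcM exprMn.
Qed.

Lemma le_sqsum X xi eta : (forall x, x \in X -> normc (xi x) <= normc (eta x)) ->
  sqsum X xi <= sqsum X eta.
Proof.
move=> h; rewrite /sqsum big_seq [leRHS]big_seq; apply: ler_sum => x /h le.
by rewrite ler_sqr// nnegrE normc_ge0.
Qed.

Lemma matrix_formD f m X H xi eta :
  matrix_form (f \+ m) X H xi eta =
  matrix_form f X H xi eta + matrix_form m X H xi eta.
Proof.
rewrite /matrix_form -big_split; apply: eq_bigr => x _ /=.
by rewrite -big_split; apply: eq_bigr => h _ /=; rewrite !mulrDl.
Qed.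

Lemma matrix_formZ f z X H xi eta :
  matrix_form (fun y => z * f y) X H xi eta = z * matrix_form f X H xi eta.
Proof.
rewrite /matrix_form mulr_sumr; apply: eq_bigr => x _.
by rewrite mulr_sumr; apply: eq_bigr => h _; rewrite !mulrA.
Qed.

Lemma matrix_formZl f z X H xi eta :
  matrix_form f X H (fun h => z * xi h) eta = z * matrix_form f X H xi eta.
Proof.
rewrite -matrix_formZ; apply: eq_bigr => x _; apply: eq_bigr => h _.
by rewrite mulrA [f _ * z]mulrC.
Qed.

Lemma le_opbound f C D : opbound f C -> C <= D -> opbound f D.
Proof.
move=> fC CD u X H xi eta Xu Hu; apply: le_trans (fC _ _ _ _ _ Xu Hu) _.
by rewrite ler_wpM2r ?addr_ge0 ?sqsum_ge0// ler_pM2r ?invr_gt0.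
Qed.

Lemma opbound0 : opbound (fun=> 0) 0.
Proof.
move=> u X H xi eta _ _; rewrite /matrix_form big1 ?Normc.normc0 ?mul0r// => x _.
by rewrite big1// => h _; rewrite !mul0r.
Qed.

Lemma opboundD f m C D : opbound f C -> opbound m D -> opbound (f \+ m) (C + D).
Proof.
move=> fC mD u X H xi eta Xu Hu; rewrite matrix_formD.
apply: le_trans (normcD _ _) _; rewrite !mulrDl.
exact: lerD (fC _ _ _ _ _ Xu Hu) (mD _ _ _ _ _ Xu Hu).
Qed.

Lemma opboundZ f z C : opbound f C -> opbound (fun y => z * f y) (normc z * C).
Proof.
move=> fC u X H xi eta Xu Hu; rewrite matrix_formZ Normc.normcM -!mulrA.
by rewrite ler_wpM2l ?normc_ge0// mulrA; exact: fC Xu Hu.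
Qed.

Lemma opboundB f m C D : opbound f C -> opbound m D -> opbound (f \- m) (C + D).
Proof.
move=> fC /(@opboundZ _ (-1)); rewrite normcN Normc.normc1 mul1r => mD.
by rewrite (_ : f \- m = f \+ (fun y => -1 * m y));
  [exact: opboundD|apply/funext => y /=; rewrite mulN1r].
Qed.

(** The bound passes to uniform limits since each matrix form is a finite
    sum. *)
Lemma opbound_uniform_limit f C :
  (forall e, 0 < e -> exists2 m, opbound m C & forall x, normc (m x - f x) < e) ->
  opbound f C.
Proof.
move=> lim u X H xi eta Xu Hu.
set S := \sum_(x <- X) \sum_(h <- H) normc (xi h) * normc (eta x).
have S0 : 0 <= S.
  by apply: sumr_ge0 => x _; apply: sumr_ge0 => h _; rewrite mulr_ge0 ?normc_ge0.
apply/ler_addgt0Pr => e e0.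
have [m mC mf] := lim (e / (S + 1)) (divr_gt0 e0 (ltr_wpDl S0 ltr01)).
have -> : f = m \+ (f \- m) by apply/funext => y /=; rewrite addrC subrK.
rewrite matrix_formD; apply: le_trans (normcD _ _) (lerD (mC _ _ _ _ _ Xu Hu) _).
apply: (@le_trans _ _ (e / (S + 1) * S)).
  apply: le_trans (normc_sum _ _ _) _; rewrite mulr_sumr; apply: ler_sum => x _.
  apply: le_trans (normc_sum _ _ _) _; rewrite mulr_sumr; apply: ler_sum => h _.
  rewrite !Normc.normcM -mulrA ler_wpM2r ?mulr_ge0 ?normc_ge0//.
  by rewrite normcB ltW.
rewrite mulrAC -mulrA ler_piMr ?(ltW e0)// ler_pdivrMr ?mul1r ?lerDl//.
exact: ltr_wpDl.
Qed.

(** Completing the square: the scaling that turns the additive form of the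
    bound into its usual quadratic form. *)
Lemma scaling_bound (S T C : R) : 0 <= C ->
  (forall mu : R, 0 <= mu -> mu * S <= C / 2 * (mu ^+ 2 * T + S)) -> S <= C ^+ 2 * T.
Proof.
move=> C0 h; have [C0'|Cpos] := eqVneq C 0.
  by have := h 1 ler01; rewrite C0' !mul0r expr0n /= !mul0r mul1r.
have {}Cpos : 0 < C by rewrite lt0r Cpos.
have := h C C0; rewrite -[C / 2 * _]mulrA ler_pM2l// => hS.
have : 2 * S <= C ^+ 2 * T + S.
  by rewrite -ler_pdivlMl// .
by rewrite mulrDl mul1r lerD2r.
Qed.

Lemma conj_mul_normc (z : R[i]) : z * z^*%C = (normc z ^+ 2)%:C.
Proof. by rewrite -sqr_normc normr_normc rmorphXn. Qed.

Lemma normc_conj (z : R[i]) : normc z^*%C = normc z.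
Proof. by have := normcJ z; rewrite !normr_normc => /(congr1 (@complex.Re R)). Qed.

Lemma normc_real (t : R) : 0 <= t -> normc t%:C = t.
Proof. by move=> t0; rewrite /Normc.normc /= expr0n /= addr0 sqrtr_sqr ger0_norm. Qed.

(** A column is the image of a basis vector: test the form against the conjugate
    of the column. *)
Lemma opbound_column f C u H : opbound f C -> 0 <= C -> units Gr u ->
  in_fiber u H -> sqsum H f <= C ^+ 2.
Proof.
move=> fC C0 uu Hu; rewrite -[leRHS]mulr1; apply: scaling_bound => // mu mu0.
have u1 : in_fiber u [fset u]%fset by move=> x /fset1P ->; exact: unit_src.
have := fC _ _ _ (fun=> mu%:C) (fun x => (f x)^*%C) Hu u1.
have -> : matrix_form f H [fset u]%fset (fun=> mu%:C) (fun x => (f x)^*%C) =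
    (mu * sqsum H f)%:C.
  rewrite rmorphM rmorph_sum /= mulr_sumr; apply: eq_big_seq => x xH.
  by rewrite big_seq_fset1 -{1}(Hu x xH) div_src mulrAC conj_mul_normc mulrC.
rewrite normc_real ?mulr_ge0 ?sqsum_ge0//.
rewrite [sqsum [fset u]%fset _]/sqsum big_seq_fset1 normc_real// mulr1.
by rewrite /sqsum; under [X in _ <= _ * (_ + X)]eq_bigr do rewrite normc_conj.
Qed.

Lemma opbound_row f C x H : opbound f C -> 0 <= C -> in_fiber (src x) H ->
  sqsum H (fun h => f (mul x (inv h))) <= C ^+ 2.
Proof.
move=> fC C0 Hx; rewrite -[leRHS]mulr1; apply: scaling_bound => // mu mu0.
have x1 : in_fiber (src x) [fset x]%fset by move=> y /fset1P ->.
have := fC _ _ _ (fun h => (f (mul x (inv h)))^*%C) (fun=> mu%:C) x1 Hx.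
have -> : matrix_form f [fset x]%fset H (fun h => (f (mul x (inv h)))^*%C)
    (fun=> mu%:C) = (mu * sqsum H (fun h => f (mul x (inv h))))%:C.
  rewrite rmorphM rmorph_sum /= mulr_sumr /matrix_form big_seq_fset1.
  by apply: eq_bigr => h _; rewrite conj_mul_normc mulrC.
rewrite normc_real ?mulr_ge0 ?sqsum_ge0//.
rewrite [sqsum [fset x]%fset _]/sqsum big_seq_fset1 normc_real// mulr1 addrC.
by rewrite /sqsum; under [X in _ <= _ * (_ + X)]eq_bigr do rewrite normc_conj.
Qed.

Lemma opbound_sup f C x : opbound f C -> 0 <= C -> normc (f x) <= C.
Proof.
move=> fC C0; have x1 : in_fiber (src x) [fset x]%fset by move=> y /fset1P ->.
have := opbound_column fC C0 (src_unit Gr x) x1.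
by rewrite /sqsum big_seq_fset1 ler_sqr ?nnegrE ?normc_ge0.
Qed.

Lemma sqsum_atmost1 (Y : {fset G}) (b : G -> bool) (t : R) : 0 <= t ->
  (forall x y, x \in Y -> y \in Y -> b x -> b y -> x = y) ->
  \sum_(x <- Y | b x) t <= t.
Proof.
move=> t0 b1; have [[x xY bx]|nb] := pselect (exists2 x, x \in Y & b x).
  rewrite big_mkcond (big_fsetD1 x)//= bx big_seq big1 ?addr0// => y.
  rewrite !inE => /andP[yx yY]; case: ifP => // by_.
  by move: yx; rewrite (b1 _ _ xY yY bx by_) eqxx.
rewrite big_seq_cond big1// => x /andP[xY bx].
by exfalso; apply: nb; exists x.
Qed.

(** The matrix of a function supported on a bisection has at most one nonzero
    entry in each row and column. *)
Lemma opbound_bisection f V B : bisection Gr V -> (forall y, ~ V y -> f y = 0) ->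
  (forall y, normc (f y) <= B) -> 0 <= B -> opbound f B.
Proof.
move=> [injs injr] f0 fB B0 u X H xi eta Xu Hu.
pose b x h := (mul x (inv h)) \in V.
apply: (@le_trans _ _ (\sum_(x <- X) \sum_(h <- H | b x h)
  (B / 2 * normc (xi h) ^+ 2 + B / 2 * normc (eta x) ^+ 2))).
  apply: le_trans (normc_sum _ _ _) _; apply: ler_sum => x _.
  apply: le_trans (normc_sum _ _ _) _; rewrite [leRHS]big_mkcond.
  apply: ler_sum => h _; rewrite /b; case: ifPn => [_|/negP nV]; last first.
    rewrite f0 ?mul0r ?Normc.normc0// => Vxh; apply: nV; exact: mem_set.
  rewrite -mulrA !Normc.normcM.
  apply: (@le_trans _ _ (B * (normc (xi h) * normc (eta x)))).
    by rewrite ler_wpM2r ?mulr_ge0 ?normc_ge0.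
  rewrite -mulrDr -mulrA ler_wpM2l// ler_pdivlMl//.
  by have := sqr_ge0 (normc (xi h) - normc (eta x)); nra.
under eq_bigr do rewrite big_split /=.
rewrite big_split /= mulrDr /sqsum !mulr_sumr; apply: lerD.
  rewrite (exchange_big_dep xpredT)//= big_seq [leRHS]big_seq.
  apply: ler_sum => h hH; apply: sqsum_atmost1 => [|x y xX yX /set_mem Vx /set_mem Vy].
    by rewrite mulr_ge0 ?divr_ge0 ?sqr_ge0.
  have ex : src x = src h by rewrite Xu ?Hu.
  have ey : src y = src h by rewrite Xu ?Hu.
  rewrite -(divK ex) -(divK ey); congr (mul _ _); apply: injs; rewrite ?inE//.
  by rewrite !src_div.
rewrite big_seq [leRHS]big_seq.
apply: ler_sum => x xX; apply: sqsum_atmost1 => [|h k hH kH /set_mem Vh /set_mem Vk].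
  by rewrite mulr_ge0 ?divr_ge0 ?sqr_ge0.
have eh : src x = src h by rewrite Xu ?Hu.
have ek : src x = src k by rewrite Xu ?Hu.
apply: (div_inj eh ek); apply: injr; rewrite ?inE//.
by rewrite (rng_div eh) (rng_div ek).
Qed.

End OperatorBound.
(** * The reduced norm *)

Section EtaleNorm.
Variables (R : realType) (G : topologicalType) (Gr : groupoid G).
Hypothesis (eG : etale Gr) (tdG : totally_disconnected (units Gr)).
Implicit Types (f m p q xi eta : G -> R[i]) (X H : {fset G}) (C D B : R).
Local Notation src := (Defs.src Gr).
Local Notation rng := (Defs.rng Gr).
Local Notation inv := (Defs.inv Gr).
Local Notation mul := (Defs.mul Gr).
Local Notation normc := (@Normc.normc R).

Lemma etale_Cc_ind P (Q : (G -> R[i]) -> Prop) :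
  Q (fun=> 0) -> (forall f m, Q f -> Q m -> Q (f \+ m)) ->
  (forall x, P x -> exists O, [/\ open O, O x &
     forall V, compact V -> open V -> bisection Gr V -> V `<=` O -> V x ->
     forall f, continuous f -> (forall y, ~ V y -> f y = 0) -> Q f]) ->
  forall f, Cc P f -> Q f.
Proof.
move=> Q0 QD Qloc; apply: (Cc_ind (etale_hausdorff eG) Q0 QD).
move=> x /Qloc[A [oA Ax QA]].
have [V [cV oV Vx VA bV]] := compact_open_bisection_base eG tdG oA Ax.
by exists V; split=> //; exact: QA.
Qed.

(** Functions supported in a bisection are bounded operators, and finite sums of
    them exhaust [C_c]. *)
Lemma Cc_opbound P f : Cc P f -> exists2 C, 0 <= C & opbound Gr f C.
Proof.
move: f; apply: etale_Cc_ind.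
- by exists 0 => //; exact: opbound0.
- move=> f m [C C0 fC] [D D0 mD]; exists (C + D); first exact: addr_ge0.
  exact: opboundD.
- move=> x _; exists setT; split=> //; first exact: openT.
  move=> V cV oV bV _ _ f cf f0.
  have [B B0 fB] := Cc_bounded (Cc_of_compact (P := setT) (etale_hausdorff eG)
    cV (fun _ _ => I) cf f0).
  by exists B => //; exact: opbound_bisection bV f0 fB B0.
Qed.

Lemma Cc_row_finite P f x : Cc P f ->
  finite_set [set h | src h = src x /\ f (mul x (inv h)) != 0].
Proof.
move: f; apply: etale_Cc_ind.
- by rewrite (_ : [set h | _] = set0)// -subset0 => h [_ /eqP].
- move=> f m Ff Fm; apply: sub_finite_set (_ : _ `<=` _ `|` _) _; last first.
    by rewrite finite_setU; split; [exact: Ff|exact: Fm].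
  move=> h [hx fm]; have [f0|] := eqVneq (f (mul x (inv h))) 0; last by left.
  by right; split=> //; move: fm; rewrite /= f0 add0r.
- move=> y _; exists setT; split=> //; first exact: openT.
  move=> V _ _ [_ injr] _ _ f _ f0.
  have [[h [hx fh]]|n] := pselect (exists h, src h = src x /\ f (mul x (inv h)) != 0).
    apply: (@sub_finite_set _ _ [set h]); last exact: finite_set1.
    move=> k [kx fk]; apply: (@div_inj _ Gr x) => //; apply: injr.
    + by apply/mem_set; apply: contrapT => /f0/eqP; exact/negP.
    + by apply/mem_set; apply: contrapT => /f0/eqP; exact/negP.
    + by rewrite (rng_div (esym kx)) (rng_div (esym hx)).
  by rewrite (_ : [set h | _] = set0)// -subset0 => h ?; apply: n; exists h.
Qed.

Lemma Ind_sum u f xi x H : in_fiber Gr u H ->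
  (forall h, src h = u -> h \notin H -> f (mul x (inv h)) * xi h = 0) ->
  Ind Gr u f xi x = \sum_(h <- H) f (mul x (inv h)) * xi h.
Proof.
move=> Hu H0; rewrite /Ind (@fsbigE _ _ _ _ _ (enum_fset H))//.
  rewrite big_mkcond; apply: eq_big_seq => h hH.
  by rewrite mem_set//; exact: Hu.
Qed.

Lemma Cc_row_support P f u X : Cc P f -> in_fiber Gr u X ->
  exists2 H, in_fiber Gr u H & forall H', {subset H <= H'} -> in_fiber Gr u H' ->
    forall x xi, x \in X ->
    Ind Gr u f xi x = \sum_(h <- H') f (mul x (inv h)) * xi h.
Proof.
move=> Pf Xu.
pose S := \bigcup_(x in [set` X]) [set h | src h = u /\ f (mul x (inv h)) != 0].
have fS : finite_set S.
  apply: bigcup_finite => [|x xX]; first exact: finite_fset.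
  by rewrite -(Xu x xX); exact: Cc_row_finite Pf.
exists (fset_set S).
  by move=> h; rewrite in_fset_set// => /set_mem[x _ []].
move=> H' SH' H'u x xi xX; apply: Ind_sum => // h hu hH'.
have [->|fh] := eqVneq (f (mul x (inv h))) 0; first by rewrite mul0r.
exfalso; move/negP: hH'; apply; apply: SH'.
by rewrite in_fset_set//; apply/mem_set; exists x.
Qed.

Lemma l2norm_leP u xi C : 0 <= C ->
  (l2norm Gr u xi <= C%:E)%E <->
  (forall H, in_fiber Gr u H -> sqsum H xi <= C ^+ 2).
Proof.
move=> C0; rewrite /l2norm; set E := (\esum_(h in _) _)%E.
have E0 : (0 <= E)%E.
  by apply: esum_ge0 => x _; rewrite lee_fin sqr_ge0.
have -> : (E `^ 2^-1 <= C%:E)%E <-> (E <= (C ^+ 2)%:E)%E.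
  split=> h.
    have := @gt0_ler_poweR _ 2 (ler0n _ 2) (E `^ 2^-1)%E C%:E.
    rewrite -poweRrM mulVf ?pnatr_eq0// poweRe1// poweR_EFin powR_mulrn//.
    by apply=> //; rewrite in_itv /= ?leey ?andbT ?poweR_ge0 ?lee_fin.
  have h2 : 0 <= 2^-1 :> R by rewrite invr_ge0.
  have := @gt0_ler_poweR _ 2^-1 h2 E (C ^+ 2)%:E.
  rewrite poweR_EFin -powR_mulrn// -powRrM mulfV ?pnatr_eq0// powRr1//.
  apply; [by rewrite in_itv /= leey andbT| |by rewrite powR_mulrn].
  by rewrite in_itv /= leey andbT lee_fin powR_ge0.
split=> [EC H Hu|hC].
  rewrite -lee_fin; apply: le_trans EC; rewrite /sqsum -sumEFin.
  rewrite fsbig_seq//; apply: esum_ge; exists [set` H]; last exact: lexx.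
  by split; [exact: finite_fset|move=> h /Hu].
apply: ge_ereal_sup => _ [A [fA Au] <-].
rewrite fsbig_finite// sumEFin lee_fin; apply: hC => h.
by rewrite in_fset_set// => /set_mem /Au.
Qed.

(** Testing the form against the conjugate of [Ind u f xi] recovers its
    norm. *)
Lemma Ind_norm_le P f C u : Cc P f -> opbound Gr f C -> 0 <= C ->
  (Ind_norm Gr u f <= C%:E)%E.
Proof.
move=> Pf fC C0; apply: ge_ereal_sup => _ [xi /= xi1 <-].
apply/l2norm_leP => // X Xu.
have [H Hu /(_ H (fun _ => id) Hu) IndE] := Cc_row_support Pf Xu.
have H1 : sqsum H xi <= 1.
  by have /(l2norm_leP _ _ ler01)/(_ H Hu) := xi1; rewrite expr1n.
rewrite -[leRHS]mulr1; apply: scaling_bound => // mu mu0.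
have := fC _ _ _ (fun h => mu%:C * xi h) (fun x => (Ind Gr u f xi x)^*%C) Xu Hu.
have -> : matrix_form Gr f X H (fun h => mu%:C * xi h)
    (fun x => (Ind Gr u f xi x)^*%C) = (mu * sqsum X (Ind Gr u f xi))%:C.
  rewrite matrix_formZl rmorphM rmorph_sum; congr (_ * _).
  apply: eq_big_seq => x xX; rewrite -mulr_suml -IndE//.
  exact: conj_mul_normc.
rewrite normc_real ?mulr_ge0 ?sqsum_ge0// sqsumZ normc_real//.
have -> : sqsum X (fun x => (Ind Gr u f xi x)^*%C) = sqsum X (Ind Gr u f xi).
  by apply: eq_bigr => x _; rewrite normc_conj.
move=> h; apply: le_trans h _; rewrite ler_wpM2l ?divr_ge0// lerD2r.
by rewrite ler_wpM2l ?sqr_ge0.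
Qed.

Lemma red_norm_bounds P f : Cc P f -> 0 <= red_norm Gr f /\
  forall u, units Gr u -> (Ind_norm Gr u f <= (red_norm Gr f)%:E)%E.
Proof.
move=> Pf; have [C C0 fC] := Cc_opbound Pf; rewrite /red_norm.
set E := ereal_sup _; have EC : (E <= C%:E)%E.
  by apply: ge_ereal_sup => _ [u uu <-]; exact: Ind_norm_le Pf fC C0.
have Iu u : units Gr u -> (Ind_norm Gr u f <= E)%E.
  by move=> uu; apply: ereal_sup_ubound; exists u.
have I0 u : (0 <= Ind_norm Gr u f)%E.
  apply: (@le_trans _ _ (l2norm Gr u (Ind Gr u f (fun=> 0)))).
    exact: poweR_ge0.
  apply: ereal_sup_ubound; exists (fun=> 0) => //=.
  apply/l2norm_leP => // H _; rewrite /sqsum big1 ?expr1n ?ler01// => h _.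
  by rewrite Normc.normc0 expr0n.
have [[u uu]|nu] := pselect (exists u, units Gr u).
  have E0 : (0 <= E)%E := le_trans (I0 u) (Iu u uu).
  split; first exact: fine_ge0.
  move=> v uv; rewrite fineK ?Iu// ge0_fin_numE//.
  exact: le_lt_trans EC (ltry _).
split; last by move=> u uu; exfalso; apply: nu; exists u.
rewrite (_ : E = -oo%E)// /E (_ : [set _ | _ in _] = set0) ?ereal_sup0//.
by rewrite -subset0 => y [u uu _]; apply: nu; exists u.
Qed.

Lemma red_norm_ge0 P f : Cc P f -> 0 <= red_norm Gr f.
Proof. by case/red_norm_bounds. Qed.

Lemma red_norm_le P f C : Cc P f -> opbound Gr f C -> 0 <= C -> red_norm Gr f <= C.
Proof.
move=> Pf fC C0; rewrite /red_norm; set E := ereal_sup _.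
have EC : (E <= C%:E)%E.
  by apply: ge_ereal_sup => _ [u uu <-]; exact: Ind_norm_le Pf fC C0.
by case: E EC => [r||] //=.
Qed.

(** With [y = Ind u f xi] on [X], the norm bounds [sqsum X y] by
    [C ^+ 2 * sqsum H xi] after normalizing [xi]; the mean inequality then bounds
    the pairing of [y] with [eta]. *)
Lemma red_norm_opbound P f : Cc P f -> opbound Gr f (red_norm Gr f).
Proof.
move=> Pf; have [C0 IC] := red_norm_bounds Pf; set C := red_norm Gr f in C0 IC *.
move=> u X H xi eta Xu Hu.
pose y x := \sum_(h <- H) f (mul x (inv h)) * xi h.
have formE : matrix_form Gr f X H xi eta = \sum_(x <- X) y x * eta x.
  by apply: eq_bigr => x _; rewrite mulr_suml.
have [[x0 x0X]|X0] := pselect (exists x, x \in X); last first.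
  rewrite formE big_seq big1 ?Normc.normc0.
    by rewrite mulr_ge0 ?divr_ge0 ?addr_ge0 ?sqsum_ge0.
  by move=> x xX; exfalso; apply: X0; exists x.
have uu : units Gr u by rewrite -(Xu _ x0X); exact: src_unit.
have [s0|sn0] := eqVneq (sqsum H xi) 0.
  rewrite formE big1 ?Normc.normc0 ?mulr_ge0 ?divr_ge0 ?addr_ge0 ?sqsum_ge0//.
  move=> x _; rewrite /y big_seq big1 ?mul0r// => h hH.
  suff -> : xi h = 0 by rewrite mulr0.
  apply: Normc.eq0_normc; apply/eqP; rewrite -sqrf_eq0.
  move/eqP: s0; rewrite /sqsum psumr_eq0 => [/allP/(_ h hH)//|? _].
  exact: sqr_ge0.
have spos : 0 < sqsum H xi by rewrite lt0r sn0 sqsum_ge0.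
set n := Num.sqrt (sqsum H xi).
have npos : 0 < n by rewrite sqrtr_gt0.
have n2 : n ^+ 2 = sqsum H xi by rewrite sqr_sqrtr// ltW.
pose xi' h := if h \in H then (n^-1)%:C * xi h else 0.
have xi'1 : (l2norm Gr u xi' <= 1%:E)%E.
  apply/l2norm_leP => // K Ku; rewrite expr1n /sqsum.
  have -> : \sum_(h <- K) normc (xi' h) ^+ 2 =
      \sum_(h <- K | h \in H) n^-1 ^+ 2 * normc (xi h) ^+ 2.
    rewrite [RHS]big_mkcond; apply: eq_bigr => h _; rewrite /xi'.
    case: ifP => _; last by rewrite Normc.normc0 expr0n.
    by rewrite Normc.normcM normc_real ?invr_ge0 ?(ltW npos)// exprMn.
  rewrite -big_filter.
  apply: (@le_trans _ _ (\sum_(h <- H) n^-1 ^+ 2 * normc (xi h) ^+ 2)).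
    rewrite [leRHS](bigID (mem K))/=.
    rewrite (perm_big [seq h <- H | h \in K]).
      by rewrite big_filter lerDl sumr_ge0// => h _; rewrite mulr_ge0 ?sqr_ge0.
    apply: uniq_perm; rewrite ?filter_uniq// => h.
    by rewrite !mem_filter andbC.
  by rewrite -mulr_sumr -/(sqsum H xi) -n2 -exprMn mulVf ?expr1n ?gt_eqF.
have yC : sqsum X y <= C ^+ 2 * n ^+ 2.
  have /(l2norm_leP _ _ C0)/(_ X Xu) : (l2norm Gr u (Ind Gr u f xi') <= C%:E)%E.
    apply: le_trans (IC u uu); apply: ereal_sup_ubound; exists xi' => //.
  rewrite -(ler_pdivrMr _ _ (exprn_gt0 2 npos)) => h; apply: le_trans h.
  rewrite mulrC -exprVn -[n^-1 in leLHS]normc_real ?invr_ge0 ?(ltW npos)//.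
  rewrite -sqsumZ; apply: le_sqsum => x xX; rewrite (Ind_sum (H := H))//.
    rewrite /y mulr_sumr [X in _ <= normc X](eq_big_seq (fun h =>
      (n^-1)%:C * (f (mul x (inv h)) * xi h)))// => h hH.
    by rewrite /xi' hH mulrCA.
  by move=> h _ /negbTE nH; rewrite /xi' nH mulr0.
rewrite formE; apply: le_trans (normc_sum _ _ _) _.
have [Ceq0|Cn0] := eqVneq C 0.
  rewrite Ceq0 !mul0r big_seq big1// => x xX.
  suff -> : y x = 0 by rewrite mul0r Normc.normc0.
  apply: Normc.eq0_normc; apply/eqP; rewrite -sqrf_eq0.
  have : sqsum X y == 0.
    by rewrite eq_le sqsum_ge0 andbT; move: yC; rewrite Ceq0 expr0n mul0r.
  by rewrite /sqsum psumr_eq0 => [/allP/(_ x xX)//|? _]; exact: sqr_ge0.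
have Cpos : 0 < C by rewrite lt0r Cn0.
apply: (@le_trans _ _ ((2 * C)^-1 * sqsum X y + C / 2 * sqsum X eta)).
  rewrite /sqsum !mulr_sumr -big_split /=; apply: ler_sum => x _.
  rewrite Normc.normcM -(ler_pM2l (_ : 0 < 2 * C)) ?mulr_gt0//.
  rewrite mulrDr [X in _ <= X + _]mulrA mulfV ?mul1r ?gt_eqF ?mulr_gt0//.
  by have := sqr_ge0 (normc (y x) - C * normc (eta x)); nra.
rewrite mulrDr lerD2r (_ : C / 2 * sqsum H xi = (2 * C)^-1 * (C ^+ 2 * n ^+ 2)).
  by rewrite ler_wpM2l ?invr_ge0 ?mulr_ge0.
by rewrite n2; field; exact: Cn0.
Qed.

End EtaleNorm.
(** * Contractive multipliers *)

Section Multipliers.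
Variables (R : realType) (G : topologicalType) (Gr : groupoid G).
Implicit Types (f m p q xi eta : G -> R[i]) (X H : {fset G}) (C D B : R).
Local Notation src := (Defs.src Gr).
Local Notation rng := (Defs.rng Gr).
Local Notation inv := (Defs.inv Gr).
Local Notation mul := (Defs.mul Gr).
Local Notation normc := (@Normc.normc R).

Definition contractive m : Prop :=
  forall f C, 0 <= C -> opbound Gr f C -> opbound Gr (m \* f) C.

(** A Schur multiplier of rank one: its two factors are moved to the two test
    vectors. *)
Lemma contractive_rank_one m p q :
  (forall x h, src x = src h -> m (mul x (inv h)) = p x * q h) ->
  (forall x, normc (p x) <= 1) -> (forall h, normc (q h) <= 1) -> contractive m.
Proof.
move=> mE p1 q1 f C C0 fC u X H xi eta Xu Hu.
have -> : matrix_form Gr (m \* f) X H xi eta =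
    matrix_form Gr f X H (q \* xi) (p \* eta).
  apply: eq_big_seq => x xX; apply: eq_big_seq => h hH /=.
  rewrite mE ?(Xu x xX) ?(Hu h hH)//; ring.
apply: le_trans (fC _ _ _ _ _ Xu Hu) _; rewrite ler_wpM2l ?divr_ge0//.
by apply: lerD; apply: le_sqsum => x _ /=; rewrite Normc.normcM ler_piMl ?normc_ge0.
Qed.

Lemma contractive_comp m p : contractive m -> contractive p -> contractive (m \* p).
Proof.
move=> cm cp f C C0 fC; rewrite (_ : (m \* p) \* f = m \* (p \* f)).
  by apply: cm => //; exact: cp.
by apply/funext => y /=; rewrite mulrA.
Qed.

Lemma contractive_average (N : nat) (m : nat -> G -> R[i]) : (0 < N)%N ->
  (forall k, contractive (m k)) ->
  contractive (fun y => N%:R^-1 * \sum_(k < N) m k y).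
Proof.
move=> N0 cm f C C0 fC.
have sumb n : opbound Gr (fun y => (\sum_(k < n) m k y) * f y) (n%:R * C).
  elim: n => [|n IH].
    rewrite (_ : (fun y => _) = fun=> 0) ?mul0r; first exact: opbound0.
    by apply/funext => y; rewrite big_ord0 mul0r.
  rewrite (_ : (fun y => _) = (fun y => (\sum_(k < n) m k y) * f y) \+ (m n \* f)).
    by rewrite mulrSr mulrDl mul1r; apply: opboundD => //; exact: cm.
  by apply/funext => y /=; rewrite big_ord_recr mulrDl.
have := opboundZ (N%:R^-1) (sumb N).
rewrite (_ : normc _ * _ = C); last first.
  have -> : N%:R^-1 = (N%:R^-1)%:C :> R[i] by rewrite fmorphV rmorph_nat.
  by rewrite normc_real ?invr_ge0// mulrA mulVf ?mul1r ?pnatr_eq0 -?lt0n.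
by rewrite (_ : (fun y => _) = (fun y => N%:R^-1 * \sum_(k < N) m k y) \* f)//;
  apply/funext => y /=; rewrite mulrA.
Qed.

(** Two blocks with disjoint row sets and disjoint column sets act on
    orthogonal pieces of both test vectors. *)
Lemma contractive_blocks m p (A1 A2 B1 B2 : set G) :
  contractive m -> contractive p ->
  (forall y, m y != 0 -> A1 (rng y) /\ B1 (src y)) ->
  (forall y, p y != 0 -> A2 (rng y) /\ B2 (src y)) ->
  A1 `&` A2 `<=` set0 -> B1 `&` B2 `<=` set0 -> contractive (m \+ p).
Proof.
move=> cm cp m0 p0 dA dB f C C0 fC u X H xi eta Xu Hu.
have cut g (A B : set G) : (forall y, g y != 0 -> A (rng y) /\ B (src y)) ->
    matrix_form Gr (g \* f) X H xi eta =
    matrix_form Gr (g \* f) X H ((\1_B \o rng) \* xi) ((\1_A \o rng) \* eta).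
  move=> g0; apply: eq_big_seq => x xX; apply: eq_big_seq => h hH /=.
  have e : src x = src h by rewrite (Xu x xX) (Hu h hH).
  have [->|/g0] := eqVneq (g (mul x (inv h))) 0; first by rewrite !mul0r.
  by rewrite rng_div// src_div// => -[Ax Bh]; rewrite !indicE !mem_set// !mul1r.
have -> : (m \+ p) \* f = (m \* f) \+ (p \* f).
  by apply/funext => y /=; rewrite mulrDl.
rewrite matrix_formD (cut m A1 B1)// (cut p A2 B2)//.
apply: le_trans (normcD _ _) _.
apply: le_trans (lerD (cm _ _ C0 fC _ _ _ _ _ Xu Hu) (cp _ _ C0 fC _ _ _ _ _ Xu Hu)) _.
rewrite -mulrDr ler_wpM2l ?divr_ge0// addrACA.
have split2 Y (A B : set G) zeta : A `&` B `<=` set0 ->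
    sqsum Y ((\1_A \o rng) \* zeta) + sqsum Y ((\1_B \o rng) \* zeta) <= sqsum Y zeta.
  move=> dAB; rewrite /sqsum -big_split; apply: ler_sum => y _ /=.
  rewrite !Normc.normcM !exprMn -mulrDl ler_piMl ?sqr_ge0// !indicE.
  have [Ay|nAy] := pselect (A (rng y)).
    rewrite mem_set// memNset ?Normc.normc1 ?Normc.normc0 ?expr0n ?addr0 ?expr1n//.
    by move=> By; apply: (dAB (rng y)).
  rewrite memNset// Normc.normc0 expr0n add0r.
  by case: (_ \in _); rewrite ?Normc.normc1 ?Normc.normc0 ?expr0n ?expr1n.
by apply: lerD; exact: split2.
Qed.

(** On a function cut down to a bisection the operator bound is the sup norm,
    which never exceeds the operator bound. *)
Lemma contractive_bisection V : bisection Gr V -> contractive \1_V.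
Proof.
move=> bV f C C0 fC; apply: (opbound_bisection bV) => // y.
  by move=> nV; rewrite /= indicE memNset// mul0r.
rewrite /= Normc.normcM; apply: le_trans (opbound_sup y fC C0).
rewrite ler_piMl ?normc_ge0// indicE.
by case: (_ \in _); rewrite ?Normc.normc1 ?Normc.normc0.
Qed.

Lemma opbound_mul_src f C b B : 0 <= C -> opbound Gr f C -> 0 < B ->
  (forall y, normc (b y) <= B) -> opbound Gr ((b \o src) \* f) (B * C).
Proof.
move=> C0 fC B0 bB.
have cb : contractive (fun y => B^-1%:C * b (src y)).
  apply: (@contractive_rank_one _ (fun=> 1) (fun h => B^-1%:C * b (rng h))).
  - by move=> x h e; rewrite src_div// mul1r.
  - by move=> x; rewrite Normc.normc1.
  - move=> h; rewrite Normc.normcM normc_real ?invr_ge0 ?(ltW B0)//.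
    by rewrite ler_pdivrMl// mulr1.
have := opboundZ B%:C (cb f C C0 fC); rewrite normc_real ?(ltW B0)//.
congr opbound; apply/funext => y /=.
by rewrite !mulrA -rmorphM mulfV ?gt_eqF// mul1r.
Qed.

Lemma opbound_mul_rng f C b B : 0 <= C -> opbound Gr f C -> 0 < B ->
  (forall y, normc (b y) <= B) -> opbound Gr ((b \o rng) \* f) (B * C).
Proof.
move=> C0 fC B0 bB.
have cb : contractive (fun y => B^-1%:C * b (rng y)).
  apply: (@contractive_rank_one _ (fun h => B^-1%:C * b (rng h)) (fun=> 1)).
  - by move=> x h e; rewrite rng_div// mulr1.
  - move=> h; rewrite Normc.normcM normc_real ?invr_ge0 ?(ltW B0)//.
    by rewrite ler_pdivrMl// mulr1.
  - by move=> x; rewrite Normc.normc1.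
have := opboundZ B%:C (cb f C C0 fC); rewrite normc_real ?(ltW B0)//.
congr opbound; apply/funext => y /=.
by rewrite !mulrA -rmorphM mulfV ?gt_eqF// mul1r.
Qed.

End Multipliers.

(** * Elements of the reduced algebra *)

Section ReducedElements.
Variables (R : realType) (G : topologicalType) (Gr : groupoid G).
Hypothesis (eG : etale Gr) (tdG : totally_disconnected (units Gr)).
Implicit Types (f m a b k : G -> R[i]) (C D B e : R).
Local Notation src := (Defs.src Gr).
Local Notation rng := (Defs.rng Gr).
Local Notation inv := (Defs.inv Gr).
Local Notation mul := (Defs.mul Gr).
Local Notation normc := (@Normc.normc R).

(** A Cauchy sequence in [C_c(G)] approximates its pointwise limit in operator
    bound, since bounds pass to the limit. *)
Lemma represents_opbound (f_ : nat -> G -> R[i]) a : represents Gr f_ a ->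
  forall e, 0 < e -> \forall n \near \oo, opbound Gr (f_ n \- a) e.
Proof.
move=> [Cf cauchy lim] e e0; have [[A A'] [/= [N _ NA] [N' _ NA']] AA] := cauchy e e0.
exists (maxn N N') => // n /=; rewrite geq_max => /andP[Nn N'n].
apply: opbound_uniform_limit => d d0.
have [N2 _ N2f] := (cvg_uniform_normc _ _).1 lim d d0.
pose k := maxn N' N2; exists (f_ n \- f_ k).
  apply: le_opbound (red_norm_opbound eG tdG (Cc_sub (Cf n) (Cf k))) _.
  apply/ltW; apply: (AA (n, k)); split=> /=; first exact: NA.
  by apply: NA' => /=; rewrite leq_maxl.
move=> x /=; have := N2f k (leq_maxr _ _) x; congr (_ < _).
by rewrite -normcN; congr normc; ring.
Qed.

Lemma represents_of_opbound (f_ : nat -> G -> R[i]) a : (forall n, Cc setT (f_ n)) ->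
  (forall e, 0 < e -> \forall n \near \oo, opbound Gr (f_ n \- a) e) ->
  represents Gr f_ a.
Proof.
move=> Cf lim; split=> // [e e0|].
  have e3 : 0 < e / 3 by rewrite divr_gt0.
  have [N _ Nf] := lim _ e3.
  exists ([set n | (N <= n)%N], [set n | (N <= n)%N]).
    by split; exists N.
  move=> [m n] /= [Nm Nn]; apply: (@le_lt_trans _ _ (e / 3 + e / 3)); last by lra.
  apply: (red_norm_le eG tdG (Cc_sub (Cf m) (Cf n))); last by lra.
  rewrite (_ : f_ m \- f_ n = (f_ m \- a) \- (f_ n \- a)).
    by apply: opboundB; exact: Nf.
  by apply/funext => y /=; ring.
apply/cvg_uniform_normc => e e0; have e2 : 0 < e / 2 by rewrite divr_gt0.
apply: filterS (lim _ e2) => n fn x.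
by apply: le_lt_trans (opbound_sup x fn (ltW e2)) _; lra.
Qed.

(** The reduced algebra consists of the functions that [C_c(G)] approximates in
    operator bound; this criterion avoids representing sequences. *)
Lemma CrP a : Cr Gr a <->
  forall e, 0 < e -> exists2 f, Cc setT f & opbound Gr (f \- a) e.
Proof.
split=> [[f_ fa] e e0|h].
  have [N _ Nf] := represents_opbound fa e0; have [Cf _ _] := fa.
  by exists (f_ N) => //; exact: (Nf N (leqnn N)).
have /choice[f_ hf] : forall n : nat,
    exists f, Cc setT f /\ opbound Gr (f \- a) n.+1%:R^-1.
  move=> n; have n0 : 0 < n.+1%:R^-1 :> R by rewrite invr_gt0 ltr0n.
  by have [f Cf fa] := h _ n0; exists f.
exists f_; apply: represents_of_opbound => [n|e e0]; first by case: (hf n).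
near=> n; apply: le_opbound (hf n).2 _; apply: ltW.
near: n; exact: near_infty_natSinv_lt (PosNum e0).
Unshelve. all: by end_near.
Qed.

Lemma Cr_bounded a : Cr Gr a -> exists2 C, 0 < C & opbound Gr a C.
Proof.
move=> /CrP/(_ 1 ltr01)[f Cf fa]; have [C C0 fC] := Cc_opbound eG tdG Cf.
exists (C + 1); first exact: ltr_wpDl.
rewrite (_ : a = f \- (f \- a)); first exact: opboundB.
by apply/funext => y /=; ring.
Qed.

Lemma Cr_continuous a : Cr Gr a -> continuous a.
Proof.
move=> /CrP ha x A /nbhs_complexP[e e0 eA].
have e3 : 0 < e / 3 by rewrite divr_gt0.
have [f [cf _ _] fa] := ha _ e3.
apply: filterS (near_normc x cf e3) => y /= fyx; apply: eA.
rewrite (_ : a y - a x = (f x - a x) - (f y - a y) + (f y - f x)); last by ring.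
have := opbound_sup x fa (ltW e3); have := opbound_sup y fa (ltW e3).
move=> /= hy hx; apply: le_lt_trans (normcD _ _) _.
apply: (@le_lt_trans _ _ (e / 3 + e / 3 + normc (f y - f x))); last by lra.
by rewrite lerD2r; apply: le_trans (normcD _ _) _; rewrite normcN lerD.
Qed.

Lemma Cr_sub a b : Cr Gr a -> Cr Gr b -> Cr Gr (a \- b).
Proof.
move=> /CrP ha /CrP hb; apply/CrP => e e0.
have e2 : 0 < e / 2 by rewrite divr_gt0.
have [f Cf fa] := ha _ e2; have [g Cg gb] := hb _ e2.
exists (f \- g); first exact: Cc_sub.
rewrite [e]splitr (_ : _ \- _ = (f \- a) \- (g \- b)); first exact: opboundB.
by apply/funext => y /=; ring.
Qed.

Lemma Cr_multiplier m a : continuous m -> contractive Gr m -> Cr Gr a -> Cr Gr (m \* a).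
Proof.
move=> cm ctm /CrP ha; apply/CrP => e e0; have [f Cf fa] := ha e e0.
exists (m \* f); first exact: (Cc_mul Cf cm).
rewrite (_ : _ \- _ = m \* (f \- a)); first exact: (ctm _ _ (ltW e0) fa).
by apply/funext => y /=; rewrite mulrBr.
Qed.

(** The norms of any representing sequence converge to the least operator bound
    of the limit, so the infimum defining [Cr_norm] is at most that bound. *)
Lemma Cr_norm_le a e : Cr Gr a -> opbound Gr a e -> 0 <= e -> Cr_norm Gr a <= e.
Proof.
move=> [f_ fa] ae e0; have [Cf _ _] := fa.
pose S := [set C | 0 <= C /\ opbound Gr a C].
have infS : has_inf S by split; [exists e|exists 0 => C []].
have lim : red_norm Gr (f_ n) @[n --> \oo] --> inf S.
  apply/cvgrPdist_le => d d0; near=> n.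
  have fn : opbound Gr (f_ n \- a) d by near: n; exact: represents_opbound.
  have Ca : red_norm Gr (f_ n) + d \in S.
    apply/mem_set; split.
      by rewrite addr_ge0 ?(ltW d0)//; exact: red_norm_ge0 (Cf n).
    rewrite (_ : a = f_ n \- (f_ n \- a)).
      by apply: opboundB => //; exact: red_norm_opbound (Cf n).
    by apply/funext => y /=; ring.
  rewrite ler_distl; apply/andP; split.
    apply: lb_le_inf => [|C [C0 aC]]; first by exists e.
    rewrite lerBlDr; apply: (red_norm_le eG tdG (Cf n)); last first.
      by rewrite addr_ge0 ?(ltW d0).
    rewrite (_ : f_ n = a \+ (f_ n \- a)); first exact: opboundD.
    by apply/funext => y /=; ring.
  by apply: ge_inf; [exists 0 => C []|exact: set_mem].
apply: (@le_trans _ _ (inf S)).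
  apply: ge_inf; last by exists f_.
  exists 0 => x [g_ [Cg _ _] gx]; rewrite -(cvg_lim _ gx)//.
  apply: limr_ge; first by apply/cvg_ex; exists x.
  by apply: nearW => n; exact: red_norm_ge0 (Cg n).
by apply: ge_inf; [exists 0 => C []|split].
Unshelve. all: by end_near.
Qed.

End ReducedElements.
(** * Products with the diagonal *)

Section DiagonalProducts.
Variables (R : realType) (G : topologicalType) (Gr : groupoid G).
Hypothesis (eG : etale Gr) (tdG : totally_disconnected (units Gr)).
Implicit Types (f m a b k : G -> R[i]) (C D B e : R).
Local Notation src := (Defs.src Gr).
Local Notation rng := (Defs.rng Gr).
Local Notation inv := (Defs.inv Gr).
Local Notation mul := (Defs.mul Gr).
Local Notation normc := (@Normc.normc R).

(** This part of [C0_units] is enough to localize, and each of its elements is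
    represented by a constant sequence. *)
Definition diagonal b : Prop := Cc setT b /\ forall x, ~ units Gr x -> b x = 0.

Lemma continuous_compose (g : G -> G) b : continuous g -> continuous b ->
  continuous (b \o g).
Proof. by move=> cg cb x; exact (continuous_comp (cg x) (cb (g x))). Qed.

Lemma diagonal_C0_units b : diagonal b -> C0_units Gr b.
Proof.
move=> [[cb kb _] b0]; split=> //.
  exact: (continuous_subspaceT cb).
move=> e e0; exists (closure [set g | b g != 0] `&` units Gr); split=> //.
- by apply: compact_closedI kb _; exact: units_closed.
- move=> x ux nx; have [->|bx] := eqVneq (b x) 0; first by rewrite Normc.normc0.
  by exfalso; apply: nx; split=> //; exact: subset_closure.
Qed.

Lemma convE f m x : Defs.conv Gr f m x = Ind Gr (src x) f m x.
Proof. by []. Qed.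

Lemma conv_diagonal_r f b : diagonal b -> Defs.conv Gr f b = (b \o src) \* f.
Proof.
move=> [_ b0]; apply/funext => x.
rewrite !convE; have -> := @Ind_sum _ _ Gr (src x) f b x [fset src x]%fset.
- by rewrite big_seq_fset1 div_src mulrC.
- by move=> h /fset1P ->; rewrite src_src.
- move=> h hx hn; rewrite b0 ?mulr0// => uh; move/negP: hn; apply.
  by apply/fset1P; rewrite -hx unit_src.
Qed.

Lemma conv_diagonal_l f b : diagonal b -> Defs.conv Gr b f = (b \o rng) \* f.
Proof.
move=> [_ b0]; apply/funext => x.
rewrite !convE; have -> := @Ind_sum _ _ Gr (src x) b f x [fset x]%fset.
- by rewrite big_seq_fset1 mul_inv.
- by move=> h /fset1P ->.
- move=> h hx hn; rewrite b0 ?mul0r// => uh; move/negP: hn; apply.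
  by apply/fset1P; rewrite (div_unit (esym hx) uh).
Qed.

(** An entry of a product is a row against a column. *)
Lemma conv_le P Q f m C D (x : G) : Cc P f -> Cc Q m -> 0 < C -> 0 < D ->
  opbound Gr f C -> opbound Gr m D -> normc (Defs.conv Gr f m x) <= C * D.
Proof.
move=> Pf Qm C0 D0 fC mD.
have x1 : in_fiber Gr (src x) [fset x]%fset by move=> y /fset1P ->.
have [H Hx /(_ H (fun _ => id) Hx) IE] := Cc_row_support eG tdG Pf x1.
rewrite convE; have -> := IE x m (fset11 x).
apply: le_trans (normc_sum _ _ _) _.
pose F h := f (mul x (inv h)).
apply: (@le_trans _ _ ((D / (2 * C)) * sqsum H F + C / (2 * D) * sqsum H m)).
  rewrite /sqsum !mulr_sumr -big_split; apply: ler_sum => h _ /=.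
  rewrite Normc.normcM -/(F h).
  rewrite -(ler_pM2l (_ : 0 < 2 * C * D)) ?mulr_gt0//.
  rewrite (_ : _ * (_ + _) = D ^+ 2 * normc (F h) ^+ 2 + C ^+ 2 * normc (m h) ^+ 2).
    by have := sqr_ge0 (D * normc (F h) - C * normc (m h)); nra.
  by field; rewrite !gt_eqF.
have hF : sqsum H F <= C ^+ 2 := opbound_row fC (ltW C0) Hx.
have hm : sqsum H m <= D ^+ 2 := opbound_column mD (ltW D0) (src_unit Gr x) Hx.
have -> : C * D = D / (2 * C) * C ^+ 2 + C / (2 * D) * D ^+ 2.
  by field; rewrite !gt_eqF.
by apply: lerD; rewrite ler_wpM2l// divr_ge0 ?mulr_ge0 ?(ltW C0) ?(ltW D0).
Qed.

Lemma conv_subr P f (g : G -> R[i]) b (x : G) : Cc P f ->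
  Defs.conv Gr f (g \- b) x = Defs.conv Gr f g x - Defs.conv Gr f b x.
Proof.
move=> Pf; have x1 : in_fiber Gr (src x) [fset x]%fset by move=> y /fset1P ->.
have [H Hx /(_ H (fun _ => id) Hx) IE] := Cc_row_support eG tdG Pf x1.
rewrite !convE; have -> := IE x (g \- b) (fset11 x); have -> := IE x g (fset11 x).
have -> := IE x b (fset11 x); rewrite -sumrB.
by apply: eq_bigr => h _; rewrite /= mulrBr.
Qed.

Lemma conv_subl P f (g : G -> R[i]) b (x : G) : Cc P g -> Cc P b ->
  Defs.conv Gr (g \- b) f x = Defs.conv Gr g f x - Defs.conv Gr b f x.
Proof.
move=> Pg Pb; have x1 : in_fiber Gr (src x) [fset x]%fset by move=> y /fset1P ->.
have [H1 H1x I1] := Cc_row_support eG tdG Pg x1.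
have [H2 H2x I2] := Cc_row_support eG tdG Pb x1.
have [H3 H3x I3] := Cc_row_support eG tdG (Cc_sub Pg Pb) x1.
pose H := (H1 `|` H2 `|` H3)%fset.
have Hx : in_fiber Gr (src x) H.
  by move=> h; rewrite !in_fsetU => /orP[/orP[/H1x|/H2x]|/H3x].
have s1 : {subset H1 <= H} by move=> h hH; rewrite !in_fsetU hH.
have s2 : {subset H2 <= H} by move=> h hH; rewrite !in_fsetU hH orbT.
have s3 : {subset H3 <= H} by move=> h hH; rewrite !in_fsetU hH !orbT.
rewrite !convE; have -> := I1 H s1 Hx x f (fset11 x).
have -> := I2 H s2 Hx x f (fset11 x).
have -> := I3 H s3 Hx x f (fset11 x); rewrite -sumrB.
by apply: eq_bigr => h _; rewrite /= mulrBl.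
Qed.

Lemma represents_cst f : Cc setT f -> represents Gr (fun=> f) f.
Proof.
move=> Cf; apply: represents_of_opbound => // e e0; apply: nearW => _.
rewrite (_ : f \- f = fun=> 0); last by apply/funext => y /=; rewrite subrr.
by apply: le_opbound (ltW e0); exact: opbound0.
Qed.

Lemma diagonal_bounded b : diagonal b -> exists2 B, 0 < B & forall x, normc (b x) <= B.
Proof.
move=> [/Cc_bounded[B B0 bB] _]; exists (B + 1); first exact: ltr_wpDl.
by move=> x; apply: le_trans (bB x) _; rewrite lerDl.
Qed.

Lemma represents_sup (f_ : nat -> G -> R[i]) a : represents Gr f_ a ->
  forall e, 0 < e -> \forall n \near \oo, forall x, normc (f_ n x - a x) < e.
Proof. by move=> [_ _ /cvg_uniform_normc]. Qed.

Lemma represents_bounded (f_ : nat -> G -> R[i]) a : represents Gr f_ a ->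
  exists2 C, 0 < C & \forall n \near \oo, opbound Gr (f_ n) C.
Proof.
move=> fa; have [C C0 aC] : exists2 C, 0 < C & opbound Gr a C.
  by apply: Cr_bounded => //; exists f_.
exists (C + 1); first exact: addr_gt0.
apply: filterS (represents_opbound eG tdG fa ltr01) => n fn.
rewrite (_ : f_ n = a \+ (f_ n \- a)); first exact: opboundD.
by apply/funext => y /=; ring.
Qed.

(** The chosen value of [Cr_mul] can only be [k0] when all products of representing
    sequences have the limit [k0]. *)
Lemma Cr_mul_eq a b (k0 : G -> R[i]) :
  (exists f_ g_ : nat -> G -> R[i], [/\ represents Gr f_ a, represents Gr g_ b &
     represents Gr (fun n => Defs.conv Gr (f_ n) (g_ n)) k0]) ->
  (forall (f_ g_ : nat -> G -> R[i]), represents Gr f_ a -> represents Gr g_ b ->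
     forall e, 0 < e -> \forall n \near \oo, forall x,
       normc (Defs.conv Gr (f_ n) (g_ n) x - k0 x) < e) ->
  Cr_mul Gr a b = k0.
Proof.
move=> ex lim; rewrite /Cr_mul; set S := [set k | _].
have [f_ [g_ [fa gb fgk]]] : S (get S) by apply: getPex; exists k0.
apply/funext => x; apply/eqP; rewrite -subr_eq0; apply/eqP/Normc.eq0_normc.
apply/eqP; rewrite eq_le normc_ge0 andbT; apply/ler_addgt0Pr => e e0; rewrite add0r.
have e2 : 0 < e / 2 by rewrite divr_gt0.
have [n [h1 h2]] := filter_ex (filterI (represents_sup fgk e2) (lim _ _ fa gb _ e2)).
rewrite (_ : get S x - k0 x = (Defs.conv Gr (f_ n) (g_ n) x - k0 x) -
  (Defs.conv Gr (f_ n) (g_ n) x - get S x)); last by ring.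
apply: le_trans (normcD _ _) _; rewrite normcN.
have := h1 x; have := h2 x; lra.
Qed.

(** Convolution of [f_ n] with [g_ n] differs from [f_ n] times the diagonal
    function by [conv (f_ n) (g_ n - b)], whose entries are small by [conv_le]. *)
Lemma Cr_mul_diagonal_r a b : Cr Gr a -> diagonal b ->
  Cr_mul Gr a b = (b \o src) \* a.
Proof.
move=> [f_ fa] db; have [Cb _] := db; have [B B0 bB] := diagonal_bounded db.
have [Cf _ _] := fa; have [cb _ _] := Cb.
have cbs : continuous (b \o src)  := continuous_compose (src_continuous eG) cb.
apply: Cr_mul_eq.
  exists f_, (fun=> b); split; [exact fa|exact (represents_cst Cb)|].
  apply: (represents_of_opbound eG tdG) => [n|e e0].
    rewrite (conv_diagonal_r _ db); exact (Cc_mul (Cf n) cbs).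
  have e1 : 0 < B^-1 * e by rewrite mulr_gt0 ?invr_gt0.
  apply: filterS (represents_opbound eG tdG fa e1) => n fn.
  rewrite (conv_diagonal_r _ db).
  rewrite (_ : _ \- _ = (b \o src) \* (f_ n \- a)); last first.
    by apply/funext => y /=; rewrite mulrBr.
  have := opbound_mul_src (ltW e1) fn B0 bB.
  by rewrite mulrA mulfV ?gt_eqF// mul1r.
move=> f'_ g_ f'a gb e e0.
have [C C0 f'C] := represents_bounded f'a; have [Cf' _ _] := f'a; have [Cg _ _] := gb.
have e1 : 0 < e / (4 * C) by rewrite divr_gt0 ?mulr_gt0.
have e2 : 0 < e / (2 * B) by rewrite divr_gt0 ?mulr_gt0.
apply: filterS (filterI f'C
  (filterI (represents_opbound eG tdG gb e1) (represents_sup f'a e2))).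
move=> n [fnC [gn fn]] x.
have := conv_le x (Cf' n) (Cc_sub (Cg n) Cb) C0 e1 fnC gn.
rewrite (conv_subr _ _ _ (Cf' n)) (conv_diagonal_r _ db) /= => h1.
rewrite (_ : Defs.conv Gr (f'_ n) (g_ n) x - b (src x) * a x =
  (Defs.conv Gr (f'_ n) (g_ n) x - b (src x) * f'_ n x) +
  b (src x) * (f'_ n x - a x)); last by ring.
apply: le_lt_trans (normcD _ _) _; rewrite Normc.normcM.
have h2 : normc (b (src x)) * normc (f'_ n x - a x) <= B * (e / (2 * B)).
  by apply: ler_pM; rewrite ?normc_ge0// ltW.
apply: (@le_lt_trans _ _ (C * (e / (4 * C)) + B * (e / (2 * B)))).
  exact: lerD.
rewrite (_ : _ + _ = e * (3 / 4)); first by lra.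
by field; rewrite !gt_eqF.
Qed.

Lemma Cr_mul_diagonal_l a b : Cr Gr a -> diagonal b ->
  Cr_mul Gr b a = (b \o rng) \* a.
Proof.
move=> [f_ fa] db; have [Cb _] := db; have [B B0 bB] := diagonal_bounded db.
have [Cf _ _] := fa; have [cb _ _] := Cb.
have cbr : continuous (b \o rng)  := continuous_compose (rng_continuous eG) cb.
apply: Cr_mul_eq.
  exists (fun=> b), f_; split; [exact (represents_cst Cb)|exact fa|].
  apply: (represents_of_opbound eG tdG) => [n|e e0].
    rewrite (conv_diagonal_l _ db); exact (Cc_mul (Cf n) cbr).
  have e1 : 0 < B^-1 * e by rewrite mulr_gt0 ?invr_gt0.
  apply: filterS (represents_opbound eG tdG fa e1) => n fn.
  rewrite (conv_diagonal_l _ db).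
  rewrite (_ : _ \- _ = (b \o rng) \* (f_ n \- a)); last first.
    by apply/funext => y /=; rewrite mulrBr.
  have := opbound_mul_rng (ltW e1) fn B0 bB.
  by rewrite mulrA mulfV ?gt_eqF// mul1r.
move=> g_ f'_ gb f'a e e0.
have [C C0 f'C] := represents_bounded f'a; have [Cf' _ _] := f'a; have [Cg _ _] := gb.
have e1 : 0 < e / (4 * C) by rewrite divr_gt0 ?mulr_gt0.
have e2 : 0 < e / (2 * B) by rewrite divr_gt0 ?mulr_gt0.
apply: filterS (filterI f'C
  (filterI (represents_opbound eG tdG gb e1) (represents_sup f'a e2))).
move=> n [fnC [gn fn]] x.
have := conv_le x (Cc_sub (Cg n) Cb) (Cf' n) e1 C0 gn fnC.
rewrite (conv_subl _ _ (Cg n) Cb) (conv_diagonal_l _ db) /= => h1.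
rewrite (_ : Defs.conv Gr (g_ n) (f'_ n) x - b (rng x) * a x =
  (Defs.conv Gr (g_ n) (f'_ n) x - b (rng x) * f'_ n x) +
  b (rng x) * (f'_ n x - a x)); last by ring.
apply: le_lt_trans (normcD _ _) _; rewrite Normc.normcM.
have h2 : normc (b (rng x)) * normc (f'_ n x - a x) <= B * (e / (2 * B)).
  by apply: ler_pM; rewrite ?normc_ge0// ltW.
apply: (@le_lt_trans _ _ (e / (4 * C) * C + B * (e / (2 * B)))).
  exact: lerD.
rewrite (_ : _ + _ = e * (3 / 4)); first by lra.
by field; rewrite !gt_eqF.
Qed.

End DiagonalProducts.
(** * Level sets of the cocycle *)

Section CocycleFunctions.
Variables (R : realType) (G : topologicalType) (Gr : groupoid G).
Variables (Gam : zmodType) (c : G -> Gam).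
Hypothesis hc : cocycle Gr c.
Local Notation src := (Defs.src Gr).
Local Notation rng := (Defs.rng Gr).
Local Notation inv := (Defs.inv Gr).
Local Notation mul := (Defs.mul Gr).
Local Notation normc := (@Normc.normc R).

Lemma cocycle_level_open t : open (c @^-1` [set t]).
Proof.
have [/continuousP cc _] := hc.
by apply: (cc [set t]); exact: discrete_open.
Qed.

Lemma cocycle_level_closed t : closed (c @^-1` [set t]).
Proof.
rewrite (_ : c @^-1` [set t] = ~` (c @^-1` (~` [set t]))).
  apply: open_closedC; have [/continuousP cc _] := hc.
  by apply: (cc (~` [set t])); exact: discrete_open.
by apply/seteqP; split=> y /=; [move=> -> //|move/contrapT].
Qed.

Lemma continuous_cocycle (g : Gam -> R[i]) : continuous (g \o c).
Proof.
move=> y A nA; apply: filterS (open_nbhs_nbhs (conj (cocycle_level_open (c y)) erefl)).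
by move=> z /= ->; exact: nbhs_singleton nA.
Qed.

Lemma cocycle_div x h : src x = src h -> c (mul x (inv h)) = c x - c h.
Proof.
move=> e; have [_ cM] := hc; have := cM (mul x (inv h)) h.
by rewrite (src_div e) (divK e) => /(_ erefl) ->; rewrite addrK.
Qed.

Lemma unitary_normc (chi : Gam -> R[i]) t : unitary_character chi -> normc (chi t) = 1.
Proof. by move=> [chi1 _]; exact: normc_eq1. Qed.

Lemma unitary_exp (chi : Gam -> R[i]) k : unitary_character chi ->
  unitary_character (fun t => chi t ^+ k).
Proof.
move=> [chi1 chiM]; split=> [t|s t]; first by rewrite normrX chi1 expr1n.
by rewrite chiM exprMn.
Qed.

Lemma contractive_character (chi : Gam -> R[i]) t : unitary_character chi ->
  contractive Gr (fun y => chi (c y - t)).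
Proof.
move=> uchi; have [_ chiM] := uchi.
apply: (@contractive_rank_one _ _ _ _ (fun x => chi (c x - t)) (fun h => chi (- c h))).
- by move=> x h e; rewrite (cocycle_div e) -chiM addrAC.
- by move=> x; rewrite unitary_normc.
- by move=> x; rewrite unitary_normc.
Qed.

Lemma unitary_character0 (chi : Gam -> R[i]) : unitary_character chi -> chi 0 = 1.
Proof.
move=> uchi; have [chi1 chiM] := uchi.
have c0 : chi 0 != 0 by rewrite -normr_eq0 chi1 oner_eq0.
by apply: (mulfI c0); rewrite -chiM addr0 mulr1.
Qed.

End CocycleFunctions.

(** * Localization of an invariant bimodule *)

Section Localization.
Variables (R : realType) (G : topologicalType) (Gr : groupoid G).
Hypothesis (eG : etale Gr) (tdG : totally_disconnected (units Gr)).
Variables (Gam : zmodType) (c : G -> Gam).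
Hypotheses (hc : cocycle Gr c) (prG : principal_on Gr (c @^-1` [set 0])).
Variable M : set (G -> R[i]).
Hypotheses (hM : diagonal_bimodule Gr M) (invM : dual_invariant c M).
Implicit Types (f m a b : G -> R[i]) (A K V W : set G) (e : R).
Local Notation src := (Defs.src Gr).
Local Notation rng := (Defs.rng Gr).
Local Notation inv := (Defs.inv Gr).
Local Notation mul := (Defs.mul Gr).
Local Notation normc := (@Normc.normc R).

Lemma bimodule_Cr a : M a -> Cr Gr a.
Proof. by case: hM => + _ _ _; apply. Qed.

Lemma bimodule0 : M (fun=> 0).
Proof. by have [_ []] := hM. Qed.

Lemma bimodule_lin z a b : M a -> M b -> M (fun x => z * a x + b x).
Proof. by have [_ [_ lin] _ _] := hM; exact: lin. Qed.

Lemma bimoduleD a b : M a -> M b -> M (a \+ b).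
Proof.
move=> Ma Mb; rewrite (_ : a \+ b = fun x => 1 * a x + b x).
  exact: bimodule_lin.
by apply/funext => x; rewrite mul1r.
Qed.

Lemma bimodule_closed a : Cr Gr a ->
  (forall e, 0 < e -> exists2 b, M b & opbound Gr (a \- b) e) -> M a.
Proof.
move=> Ca lim; have [_ _ clo _] := hM; apply: clo; split=> // e e0.
have e2 : 0 < e / 2 by rewrite divr_gt0.
have [b Mb ab] := lim _ e2; exists b => //.
apply: le_lt_trans (Cr_norm_le eG tdG (Cr_sub eG tdG Ca (bimodule_Cr Mb)) ab (ltW e2)) _.
lra.
Qed.

Lemma bimodule_src a b : diagonal Gr b -> M a -> M ((b \o src) \* a).
Proof.
move=> db Ma; rewrite -(Cr_mul_diagonal_r eG tdG (bimodule_Cr Ma) db).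
by have [_ _ _ /(_ a b Ma (diagonal_C0_units eG db))[]] := hM.
Qed.

Lemma bimodule_rng a b : diagonal Gr b -> M a -> M ((b \o rng) \* a).
Proof.
move=> db Ma; rewrite -(Cr_mul_diagonal_l eG tdG (bimodule_Cr Ma) db).
by have [_ _ _ /(_ a b Ma (diagonal_C0_units eG db))[]] := hM.
Qed.

(** The contractive multipliers that preserve [M]; they act on [M] and on its
    compactly supported approximants at the same time. *)
Definition bimodule_multiplier m : Prop :=
  [/\ continuous m, contractive Gr m & forall a, M a -> M (m \* a)].

Lemma bimodule_multiplier_comp m p : bimodule_multiplier m ->
  bimodule_multiplier p -> bimodule_multiplier (m \* p).
Proof.
move=> [cm km Mm] [cp kp Mp]; split.
- exact (continuous_pmul cp cm).
- exact: contractive_comp.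
- move=> a Ma; rewrite (_ : (m \* p) \* a = m \* (p \* a)); first exact/Mm/Mp.
  by apply/funext => y /=; rewrite mulrA.
Qed.

Lemma clopen_compact V : compact V -> closed V.
Proof. exact: compact_closed (etale_hausdorff eG). Qed.

Lemma compact_src V : compact V -> compact (src @` V).
Proof.
by apply: continuous_compact; apply: continuous_subspaceT; exact: src_continuous.
Qed.

Lemma compact_rng V : compact V -> compact (rng @` V).
Proof.
by apply: continuous_compact; apply: continuous_subspaceT; exact: rng_continuous.
Qed.

Lemma indicator_diagonal W : compact W -> open W -> W `<=` units Gr ->
  diagonal Gr (\1_W : G -> R[i]).
Proof.
move=> cW oW Wu.
have W0 x : ~ W x -> (\1_W : G -> R[i]) x = 0 by move=> nW; rewrite indicE memNset.
split; last by move=> x nu; apply: W0 => /Wu.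
have ci := continuous_indicator (R := R) oW (clopen_compact cW).
exact (Cc_of_compact (P := setT) (etale_hausdorff eG) cW (fun _ _ => I) ci W0).
Qed.

(** [rect A] is the indicator of the arrows from [src A] to [rng A]: compressing
    by it is multiplication by a projection of the diagonal on each side. *)
Definition rect A : G -> R[i] := (\1_(rng @` A) \o rng) \* (\1_(src @` A) \o src).

Lemma rectP A y : rect A y != 0 -> (rng @` A) (rng y) /\ (src @` A) (src y).
Proof.
rewrite /rect /= !indicE mulf_eq0 negb_or => /andP[].
have [ry|nr] := pselect ((rng @` A) (rng y)); last by rewrite memNset// eqxx.
have [sy|ns] := pselect ((src @` A) (src y)) => //.
by rewrite (memNset ns) eqxx.
Qed.

Lemma rect1 A y : A y -> rect A y = 1.
Proof. by move=> Ay; rewrite /rect /= !indicE !mem_set ?mul1r//; exists y. Qed.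

Lemma rect_multiplier A : compact A -> open A -> bimodule_multiplier (rect A).
Proof.
move=> cA oA.
have ds : diagonal Gr (\1_(src @` A) : G -> R[i]).
  apply: indicator_diagonal; [exact: compact_src|exact: src_open_map|].
  by move=> _ [x _ <-]; exact: src_unit.
have dr : diagonal Gr (\1_(rng @` A) : G -> R[i]).
  apply: indicator_diagonal; [exact: compact_rng|exact: rng_open_map|].
  by move=> _ [x _ <-]; exact: rng_unit.
have [[cs _ _] _] := ds; have [[cr _ _] _] := dr.
split.
- exact (continuous_pmul (continuous_compose (src_continuous eG) cs)
    (continuous_compose (rng_continuous eG) cr)).
- have i1 (B : set G) y : normc (\1_B y : R[i]) <= 1.
    by rewrite indicE; case: (_ \in _); rewrite ?Normc.normc1 ?Normc.normc0.
  apply: (@contractive_rank_one _ _ _ _ (\1_(rng @` A) \o rng) (\1_(src @` A) \o rng)).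
  + by move=> x h e; rewrite /rect /= rng_div// src_div.
  + by move=> x; exact: i1.
  + by move=> x; exact: i1.
- move=> a Ma; rewrite (_ : rect A \* a =
    (\1_(rng @` A) \o rng) \* ((\1_(src @` A) \o src) \* a)).
    exact/(bimodule_rng dr)/(bimodule_src ds).
  by apply/funext => y; rewrite /rect /= mulrA.
Qed.

(** If no arrow of [K] is parallel to an arrow of [V], small enough rectangles
    around [V] miss [K]; those of a finite disjoint refinement are orthogonal
    blocks since [V] is a bisection. *)
Lemma block_multiplier V K : compact V -> open V -> bisection Gr V -> compact K ->
  (forall v g, V v -> K g -> src g = src v -> rng g = rng v -> False) ->
  exists m, [/\ bimodule_multiplier m, forall y, V y -> m y = 1 &
                forall y, K y -> m y = 0].
Proof.
move=> cV oV [injs injr] cK sep.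
have injsV v w : V v -> V w -> src v = src w -> v = w.
  by move=> Vv Vw; apply: injs; rewrite inE.
have injrV v w : V v -> V w -> rng v = rng w -> v = w.
  by move=> Vv Vw; apply: injr; rewrite inE.
suff [A [[cA oA VA AV] [m [mm m1 mK mA]]]] : exists A,
    [/\ compact A, open A, V `<=` A & A `<=` V] /\
    exists m, [/\ bimodule_multiplier m, forall y, A y -> m y = 1,
      forall y, K y -> m y = 0 &
      forall y, m y != 0 -> (rng @` A) (rng y) /\ (src @` A) (src y)].
  by exists m; split=> // y /VA; exact: m1.
apply: (compact_ind (Q := fun S => exists A,
    [/\ compact A, open A, S `<=` A & A `<=` V] /\
    exists m, [/\ bimodule_multiplier m, forall y, A y -> m y = 1,
      forall y, K y -> m y = 0 &
      forall y, m y != 0 -> (rng @` A) (rng y) /\ (src @` A) (src y)]) cV).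
- exists set0; split; first by split=> //; [exact: compact0|exact: open0].
  exists (fun=> 0); split=> //; last by move=> y; rewrite eqxx.
  split=> [x|f C C0 fC|a _]; first exact: cvg_cst.
    rewrite (_ : _ \* f = fun=> 0); first by apply: (le_opbound _ C0); exact: opbound0.
    by apply/funext => y /=; rewrite mul0r.
  rewrite (_ : _ \* a = fun=> 0); first exact: bimodule0.
  by apply/funext => y /=; rewrite mul0r.
- move=> S S' S'S [A [[cA oA SA AV] hm]]; exists A; split=> //.
  by split=> // y /S'S /SA.
- move=> S S' [A [[cA oA SA AV] [m [mm m1 mK mA]]]].
  move=> [B' [[cB' oB' SB' B'V] [p' [pp' p1' pK' _]]]].
  (* remove [A] from the second set to keep the rectangles disjoint *)
  pose B := B' `\` A; have clA := clopen_compact cA.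
  have cB : compact B.
    by apply: compact_closedI cB' _; exact: open_closedC.
  have oB : open B by apply: openI oB' _; exact: closed_openC.
  have BV : B `<=` V by move=> y [/B'V].
  pose p := rect B \* p'.
  have pp : bimodule_multiplier p.
    by apply: bimodule_multiplier_comp => //; exact: rect_multiplier.
  have p0 y : p y != 0 -> (rng @` B) (rng y) /\ (src @` B) (src y).
    by rewrite /p /= mulf_eq0 negb_or => /andP[/rectP].
  have dr : rng @` A `&` rng @` B `<=` set0.
    move=> _ [[v Av <-] [w [B'w nAw] e]]; apply: nAw.
    by rewrite (injrV w v) //; [exact: B'V|exact: AV].
  have ds : src @` A `&` src @` B `<=` set0.
    move=> _ [[v Av <-] [w [B'w nAw] e]]; apply: nAw.
    by rewrite (injsV w v) //; [exact: B'V|exact: AV].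
  exists (A `|` B); split.
    split; [exact: compactU|exact: openU| |by move=> y [/AV|/BV]].
    move=> y [/SA|/SB' B'y]; first by left.
    by have [Ay|nA] := pselect (A y); [left|right].
  have [cm km Mm] := mm; have [cp kp Mp] := pp.
  exists (m \+ p); split.
  + split; first exact (continuous_padd cm cp).
      exact: (contractive_blocks km kp mA p0 dr ds).
    move=> a Ma; rewrite (_ : (m \+ p) \* a = (m \* a) \+ (p \* a)).
      by apply: bimoduleD; [exact: Mm|exact: Mp].
    by apply/funext => y /=; rewrite mulrDl.
  + move=> y [Ay|By] /=.
      have -> : p y = 0.
        apply: contrapT => /eqP/p0[rB _].
        by apply: (dr (rng y)); split=> //; exists y.
      by rewrite m1 ?addr0.
    have -> : m y = 0.
      apply: contrapT => /eqP/mA[rA _].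
      by apply: (dr (rng y)); split=> //; exists y.
    by rewrite /p /= rect1// mul1r add0r p1'//; case: By.
  + by move=> y Ky; rewrite /= mK// /p /= pK'// mulr0 addr0.
  + move=> y /= mp; have [my|/mA[[v Av <-] [w Aw <-]]] := eqVneq (m y) 0; last first.
      by split; [exists v|exists w] => //; left.
    have /p0[[v Bv <-] [w Bw <-]] : p y != 0 by move: mp; rewrite my add0r.
    by split; [exists v|exists w] => //; right.
- move=> v Vv.
  have [N [oO Ov OK]] : exists N, [/\ open N, N v & forall w w' g, N w ->
      N w' -> K g -> src g = src w -> rng g = rng w' -> False].
    apply: (compact_ind (Q := fun S => exists N, [/\ open N, N v &
      forall w w' g, N w -> N w' -> S g -> src g = src w -> rng g = rng w' ->
      False]) cK).
    + by exists setT; split=> //; exact: openT.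
    + move=> S S' S'S [N [oO Ov OS]]; exists N; split=> // w w' g Ow Ow' /S'S.
      exact: OS.
    + move=> S S' [N [oO Ov OS]] [N' [oO' N'v N'S]]; exists (N `&` N').
      split=> //; first exact: openI.
      by move=> w w' g [Ow N'w] [Ow' N'w'] [Sg|S'g];
        [exact: (OS w w' g)|exact: (N'S w w' g)].
    + have sepT (q : G -> G) g : continuous q -> q g != q v -> exists2 S, nbhs g S &
          exists N, [/\ open N, N v & forall w h, N w -> S h -> q h = q w -> False].
        move=> cq qgv; have := etale_hausdorff eG.
        rewrite open_hausdorff => /(_ _ _ qgv)[[D1 D2] /= [D1g D2v] [oD1 oD2 D12]].
        have /continuousP cqP := cq.
        exists (q @^-1` D1).
          by apply: open_nbhs_nbhs; split; [exact: cqP|exact: set_mem].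
        exists (q @^-1` D2); split; [exact: cqP|exact: set_mem|].
        move=> w h /= D2w D1h e; rewrite e in D1h.
        by have : (D1 `&` D2) (q w) by []; rewrite (eqP D12).
      move=> g Kg; have [sgv|sgv] := eqVneq (src g) (src v); last first.
        have [S nS [N [oO Ov OS]]] := sepT _ _ (src_continuous eG) sgv.
        by exists S => //; exists N; split=> // w w' h Ow Ow' Sh e _; exact: (OS w h).
      have [rgv|rgv] := eqVneq (rng g) (rng v); first by case: (sep v g).
      have [S nS [N [oO Ov OS]]] := sepT _ _ (rng_continuous eG) rgv.
      by exists S => //; exists N; split=> // w w' h Ow Ow' Sh _; exact: (OS w' h).
  have [A [cA oA Av AVO _]] := compact_open_bisection_base eG tdG (openI oV oO)
    (conj Vv Ov).
  exists A; first exact: open_nbhs_nbhs.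
  exists A; split; first by split=> // y /AVO[].
  exists (rect A); split.
  + exact: rect_multiplier.
  + by move=> y; exact: rect1.
  + move=> y Ky; apply: contrapT => /eqP/rectP[[w Aw ew] [w' Aw' ew']].
    by apply: (OK w' w y) => //; [case: (AVO _ Aw')|case: (AVO _ Aw)].
  + by move=> y; exact: rectP.
Qed.

(** Averaging the dual action over the powers of one character isolates the
    level [t] from the level [s] exactly. *)
Lemma level_multiplier s t : s != t -> exists m, [/\ bimodule_multiplier m,
  forall y, c y = t -> m y = 1 & forall y, c y = s -> m y = 0].
Proof.
move=> st; have d0 : s - t != 0 by rewrite subr_eq0.
have [chi uchi [N N0 [chid chidN]]] := character_root_of_unity R d0.
pose p k y := chi (c y - t) ^+ k.
have NC : N%:R != 0 :> R[i] by rewrite pnatr_eq0 -lt0n.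
(* the sum of the powers of a nontrivial [N]-th root of unity vanishes *)
exists (fun y => N%:R^-1 * \sum_(k < N) p k y); split; last 2 first.
- move=> y ct; rewrite (eq_bigr (fun=> 1)).
    by rewrite sumr_const card_ord mulVf.
  by move=> k _; rewrite /p ct subrr unitary_character0// expr1n.
- move=> y cs; rewrite /p cs; apply/eqP; rewrite mulf_eq0; apply/orP; right.
  have : (chi (s - t) - 1) * \sum_(k < N) chi (s - t) ^+ k == 0.
    by rewrite -subrX1 chidN subrr.
  by rewrite mulf_eq0 subr_eq0 (negbTE chid).
split.
- exact (@continuous_cocycle R _ _ _ _ hc
    (fun u => N%:R^-1 * \sum_(k < N) chi (u - t) ^+ k)).
- apply: contractive_average => // k.
  exact: (contractive_character hc t (unitary_exp k uchi)).
- move=> a Ma; have sumM n : M (fun y => (\sum_(k < n) p k y) * a y).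
    elim: n => [|n IH].
      rewrite (_ : (fun y => _) = fun=> 0); first exact: bimodule0.
      by apply/funext => y; rewrite big_ord0 mul0r.
    rewrite (_ : (fun y => _) = (fun y => chi (- t) ^+ n *
      dual_action c (fun u => chi u ^+ n) a y + (\sum_(k < n) p k y) * a y)).
      apply: bimodule_lin IH; apply: (invM (unitary_exp n uchi)).
      by exists a.
    apply/funext => y; rewrite big_ord_recr /= mulrDl addrC; congr (_ + _).
    rewrite /p /dual_action mulrA -exprMn; congr (_ ^+ n * _).
    by have [_ chiM] := uchi; rewrite mulrC -chiM.
  rewrite (_ : _ \* a = fun y => N%:R^-1 * ((\sum_(k < N) p k y) * a y) + 0).
    exact: bimodule_lin (sumM N) bimodule0.
  by apply/funext => y; rewrite addr0 /= mulrA.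
Qed.

Lemma levels_multiplier t (l : seq Gam) : exists m, [/\ bimodule_multiplier m,
  forall y, c y = t -> m y = 1 & forall y, c y \in l -> c y != t -> m y = 0].
Proof.
elim: l => [|s l [m [mm m1 m0]]].
  exists (fun=> 1); split=> //; split=> [x|f C C0 fC|a Ma]; first exact: cvg_cst.
    by rewrite (_ : _ \* f = f)//; apply/funext => y /=; rewrite mul1r.
  by rewrite (_ : _ \* a = a)//; apply/funext => y /=; rewrite mul1r.
have [->|st] := eqVneq s t.
  exists m; split=> // y; rewrite inE => /orP[/eqP ->|]; first by rewrite eqxx.
  exact: m0.
have [p [pp p1 p0]] := level_multiplier st.
exists (p \* m); split; first exact: bimodule_multiplier_comp.
  by move=> y ct; rewrite /= p1// m1// mulr1.
move=> y; rewrite inE => /orP[/eqP /p0 py _|cl ct] /=; first by rewrite py mul0r.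
by rewrite m0// mulr0.
Qed.

Lemma compact_cocycle_finite K : compact K ->
  exists l : seq Gam, forall y, K y -> c y \in l.
Proof.
move=> cK; apply: (compact_ind (Q := fun S => exists l : seq Gam,
  forall y, S y -> c y \in l) cK).
- by exists [::].
- by move=> S S' S'S [l hl]; exists l => y /S'S; exact: hl.
- move=> S S' [l hl] [l' hl']; exists (l ++ l') => y [/hl|/hl'] h;
    by rewrite mem_cat h ?orbT.
- move=> x _; exists (c @^-1` [set c x]).
    by apply: open_nbhs_nbhs; split=> //; exact: (cocycle_level_open hc).
  by exists [:: c x] => y /= ->; rewrite mem_head.
Qed.

(** Restriction to a compact open bisection [V] inside a level set keeps
    elements of [M] in [M]. On a compactly supported approximant the restriction
    coincides with a multiplier that preserves [M]; both operations are
    contractive, so the error stays small. *)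
Lemma bimodule_restriction V t a : compact V -> open V -> bisection Gr V ->
  (forall y, V y -> c y = t) -> M a -> M (\1_V \* a).
Proof.
move=> cV oV bV Vt Ma; have Ca := bimodule_Cr Ma.
have ci := continuous_indicator (R := R) oV (clopen_compact cV).
have ki : contractive Gr (\1_V : G -> R[i]) by exact: contractive_bisection.
apply: bimodule_closed => [|e e0]; first exact: Cr_multiplier.
have e2 : 0 < e / 2 by rewrite divr_gt0.
have [f Cf fa] := (CrP eG tdG a).1 Ca _ e2; have [cf kf _] := Cf.
set S := closure _ in kf.
have [l hl] := compact_cocycle_finite kf.
have [p [pp p1 p0]] := levels_multiplier t l.
(* [K] is the part of the support of [f] at level [t] that must be killed; by
   principality no arrow of [K] is parallel to an arrow of [V] *)
pose K := S `&` (c @^-1` [set t] `&` ~` V).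
have cK : compact K.
  apply: compact_closedI kf _; apply: closedI; first exact: (cocycle_level_closed hc).
  exact: open_closedC.
have [m [mm m1 mK]] : exists m, [/\ bimodule_multiplier m,
    forall y, V y -> m y = 1 & forall y, K y -> m y = 0].
  apply: block_multiplier => // v g Vv [_ [/= cg nVg]] sgv rgv; apply: nVg.
  by rewrite (cocycle_level_injective hc prG _ sgv rgv) // cg Vt.
have [cmp kmp Mmp] := bimodule_multiplier_comp mm pp.
exists ((m \* p) \* a); first exact: Mmp.
have fE : (m \* p) \* f = \1_V \* f.
  apply/funext => y /=; have [->|fy] := eqVneq (f y) 0; first by rewrite !mulr0.
  have Sy : S y by exact: subset_closure.
  rewrite indicE; have [Vy|nVy] := pselect (V y).
    by rewrite mem_set// m1// p1 ?Vt// mulr1.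
  rewrite memNset//; have [ct|ct] := eqVneq (c y) t; first by rewrite mK ?mul0r.
  by rewrite p0 ?hl// mulr0.
rewrite [e]splitr (_ : _ \- _ = ((m \* p) \* (f \- a)) \- (\1_V \* (f \- a))).
  apply: opboundB; first exact: (kmp _ _ (ltW e2) fa).
  exact: (ki _ _ (ltW e2) fa).
apply/funext => y; have /= := congr1 (fun h => h y) fE.
by move=> E; rewrite /= !mulrBr E; ring.
Qed.

(** Dividing a test function by an element of [M] that does not vanish on [V]
    gives a function on the source of [V]. *)
Lemma bimodule_Cc_bisection V t a f : compact V -> open V -> bisection Gr V ->
  (forall y, V y -> c y = t) -> M a -> (forall y, V y -> a y != 0) ->
  continuous f -> (forall y, ~ V y -> f y = 0) -> M f.
Proof.
move=> cV oV bV Vt Ma a0 cf f0; have ca := Cr_continuous eG tdG (bimodule_Cr Ma).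
have /choice[lift liftP] : forall u, exists v, (src @` V) u -> V v /\ src v = u.
  move=> u; have [[v Vv e]|n] := pselect ((src @` V) u).
    by exists v.
  by exists u.
pose b u := if u \in src @` V then f (lift u) / a (lift u) else 0.
have bE v : V v -> b (src v) = f v / a v.
  move=> Vv; have sv : (src @` V) (src v) by exists v.
  have [Vl el] := liftP _ sv; rewrite /b mem_set//; have [injs _] := bV.
  by rewrite (injs (lift (src v)) v) ?inE.
have csV : compact (src @` V) by exact: compact_src.
have cb : continuous b.
  move=> u B nB; have [[v Vv e]|nu] := pselect ((src @` V) u); last first.
    have on : open (~` (src @` V)) by apply: closed_openC; exact: (clopen_compact csV).
    apply: filterS (open_nbhs_nbhs (conj on nu)) => w /= nw.
    move: (nbhs_singleton nB); rewrite /b memNset// memNset//.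
  rewrite -e (bE v Vv) in nB *.
  have cq : (f y / a y) @[y --> v] --> f v / a v.
    exact (cvgM (cf v) (cvgV (a0 v Vv) (ca v))).
  have nq : nbhs v [set y | B (f y / a y)] := cq B nB.
  have : nbhs v ([set y | B (f y / a y)] `&` V).
    exact: filterI nq (open_nbhs_nbhs (conj oV Vv)).
  rewrite nbhsE => -[A [oA Av] AB].
  apply: filterS (open_nbhs_nbhs (conj (src_open_map eG oA) _)); last by exists v.
  by move=> _ [w /AB[Bw Vw] <-]; rewrite /= bE.
have bs0 u : ~ (src @` V) u -> b u = 0 by move=> nu; rewrite /b memNset.
have db : diagonal Gr b.
  split.
    exact (Cc_of_compact (P := setT) (etale_hausdorff eG) csV (fun _ _ => I) cb bs0).
  by move=> u nu; apply: bs0 => -[v _ e]; apply: nu; rewrite -e; exact: src_unit.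
have -> : f = (b \o src) \* (\1_V \* a).
  apply/funext => y /=; have [Vy|nV] := pselect (V y).
    by rewrite bE// indicE mem_set// mul1r divfK// a0.
  by rewrite f0// indicE memNset// mul0r mulr0.
by apply: bimodule_src db _; exact: (bimodule_restriction cV oV bV Vt Ma).
Qed.

(** Near an arrow of the spectrum some element of [M] does not vanish, and a
    partition into compact open bisections does the rest. *)
Lemma bimodule_Cc_spectrum f : Cc (spectrum M) f -> M f.
Proof.
move: f; apply: (etale_Cc_ind eG tdG).
- exact: bimodule0.
- exact: bimoduleD.
- move=> x [a Ma ax]; pose S := [set y | a y != 0] `&` c @^-1` [set c x].
  have oS : open S.
    apply: openI; last exact: (cocycle_level_open hc).
    have ca := Cr_continuous eG tdG (bimodule_Cr Ma).
    rewrite openE => y /= ay.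
    have nay : 0 < normc (a y).
      rewrite lt0r normc_ge0 andbT; apply: contra ay => /eqP ay0.
      by apply/eqP; exact: Normc.eq0_normc.
    apply: filterS (near_normc y ca nay) => z /=; apply: contraTneq => ->.
    by rewrite sub0r normcN ltxx.
  exists S; split=> //.
  move=> V cV oV bV VS _ f cf f0.
  apply: (bimodule_Cc_bisection cV oV bV (t := c x) _ Ma _ cf f0).
    by move=> y /VS[].
  by move=> y /VS[].
Qed.

End Localization.

(** * Spectral bimodules *)

Section Spectral.
Variables (R : realType) (G : topologicalType) (Gr : groupoid G).
Hypothesis (eG : etale Gr) (tdG : totally_disconnected (units Gr)).
Variables (Gam : zmodType) (c : G -> Gam).
Hypothesis hc : cocycle Gr c.
Variable M : set (G -> R[i]).
Hypothesis hM : diagonal_bimodule Gr M.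

(** Multiplication by a character of the cocycle is unitarily implemented, so
    it acts on the reduced algebra; it does not move supports. *)
Lemma spectral_dual_invariant : spectral Gr M -> dual_invariant c M.
Proof.
move=> sM chi uchi _ [a Ma <-]; rewrite sM.
move: Ma; rewrite {1}sM => -[Ca a0]; split; last first.
  by move=> x nx; rewrite /dual_action a0// mulr0.
have cchi := contractive_character hc 0 uchi.
have Ccont := @continuous_cocycle R G Gr Gam c hc (fun t => chi (t - 0)).
have := Cr_multiplier eG tdG Ccont cchi Ca.
by congr (Cr _ _); apply/funext => y; rewrite /= subr0.
Qed.

(** The approximation property reduces membership in [M] to [C_c] of the
    spectrum. *)
Lemma dual_invariant_spectral : principal_on Gr (c @^-1` [set 0]) ->
  Fourier_approximation R Gr -> dual_invariant c M -> spectral Gr M.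
Proof.
move=> prG fG invM; apply/seteqP; split=> [a Ma|a [Ca a0]].
  split; first exact: bimodule_Cr Ma.
  by move=> x nx; apply: contrapT => /eqP ax; apply: nx; exists a.
have [_ _ clo _] := hM; apply: clo; split=> // e e0.
have [_ /(_ e e0)[f [cf kf sf] af]] := fG a Ca; exists f => //.
apply: (bimodule_Cc_spectrum eG tdG hc prG hM invM); split=> //.
by move=> x /sf ax; apply: contrapT => /a0; apply/eqP.
Qed.

End Spectral.

Theorem theorem4p5 (R : realType) (G : topologicalType) (Gr : groupoid G)
    (Gam : zmodType) (c : G -> Gam) (P : set Gam)
    (Lambda : Gam -> Type) (U : forall p : Gam, Lambda p -> set G) :
  etale Gr ->
  Fourier_approximation R Gr ->
  countable [set: Gam] ->
  infinite_set [set: Gam] ->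
  cocycle Gr c ->
  totally_disconnected (units Gr) ->
  P 0 ->
  (forall p q, P p -> P q -> P (p + q)) ->
  (forall t, exists p q, [/\ P p, P q & t = p - q]) ->
  amenable_on Gr R (c @^-1` [set 0]) ->
  principal_on Gr (c @^-1` [set 0]) ->
  (forall p, P p ->
    \bigcup_i U p i = c @^-1` [set p] /\
    (forall i, [/\ compact (U p i), open (U p i) & bisection Gr (U p i)])) ->
  (forall p q (i : Lambda p) (j : Lambda q), P p -> P q ->
    src Gr @` U p i = src Gr @` U q j ->
    open (set_mul Gr (U p i) (set_inv Gr (U q j)))) ->
  (forall g, exists p q (i : Lambda p) (j : Lambda q),
    [/\ P p, P q, src Gr @` U p i = src Gr @` U q j &
        set_mul Gr (U p i) (set_inv Gr (U q j)) g]) ->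
  forall M : set (G -> R[i]), diagonal_bimodule Gr M ->
    (spectral Gr M <-> dual_invariant c M).
Proof.
move=> eG fG _ _ hc tdG _ _ _ _ prG _ _ _ M hM; split.
  exact: (spectral_dual_invariant eG tdG hc).
exact: (dual_invariant_spectral eG tdG hc hM prG fG).
Qed.
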